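(* Let $Y,Y'$ be Polish spaces, $A$ a Borel subset of $Y\times Y'$, and $(X,(f_n)_{n\in\omega})$ a converging situation. Assume that $A\leq^r_c A^f$. Then exactly one of the following holds: (a) $A$ is potentially closed; (b) there exist a Borel subset $B$ of $X$ and a topology $\tau$ on $B$ finer than the topology induced by $X$ such that $([B,\tau],(f^B_n)_{n\in\omega})$ is a converging situation and $A^f\cap B^2\leq^r_c A$, where $A^f\cap B^2$ is viewed as a subset of $[B,\tau]\times[B,\tau]$.
   Context: $(X,(f_n))$ is a converging situation if: (a) $X$ is a nonempty zero-dimensional perfect Polish space; (b) each $f_n$ is a partial homeomorphism of $X$ with clopen domain and clopen range; (c) $\Delta(X)=\overline{A^f}\setminus A^f$, where $A^f:=\bigcup_n\mathrm{Gr}(f_n)$. For $B\subseteq X$, $f^B_n$ is the restriction of $f_n$ to $B\cap f_n^{-1}(B)$. For $A\subseteq Z_1\times Z_2$, $A'\subseteq Z_1'\times Z_2'$ (topological spaces), $A\leq^r_c A'$ means there are continuous $u:Z_1\to Z_1'$, $v:Z_2\to Z_2'$ with $A=(u\times v)^{-1}(A')$. A Borel set $D\subseteq Z_1\times Z_2$ of Polish spaces is potentially closed if there are finer Polish topologies on $Z_1$, $Z_2$ making $D$ closed in the product. *)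

(* Defs.v *)
From HB Require Import structures.
From mathcomp Require Import all_boot all_order all_algebra.
From mathcomp Require Import all_classical all_reals all_analysis.

Set Implicit Arguments.
Unset Strict Implicit.
Unset Printing Implicit Defensive.

Local Open Scope classical_set_scope.

(* Completeness is phrased with filters, as in the library's [completeType],
   which cannot be used directly because it requires a pointed carrier. *)
Definition polish (R : realType) (T : topologicalType) : Prop :=
  (exists2 D : set T, countable D & dense D) /\
  (exists m : Metric R T,
     let M : metricType R := Metric.Pack m in
     (forall U : set T, open U <-> @open M U) /\
     (forall F : set_system M, ProperFilter F -> cauchy F ->
        exists l : M, F --> l)).

(* The library's [zero_dimensional] only says that points are separated by
   clopen sets, which is weaker outside of the compact case. *)
Definition clopen_basis (T : topologicalType) : Prop :=
  basis [set U : set T | clopen U].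

Definition borel (T : topologicalType) (A : set T) : Prop :=
  <<s [set U : set T | open U] >> A.

(* A topology on T is given by an inhabitant of the class [Topological T];
   "finer" is meant in the wide sense. *)
Definition finer (T : topologicalType) (tau : Topological T) : Prop :=
  forall U : set T, open U -> @open (Topological.Pack tau) U.

Definition potentially_closed (R : realType) (Z1 Z2 : topologicalType)
    (D : set (Z1 * Z2)) : Prop :=
  exists (tau1 : Topological Z1) (tau2 : Topological Z2),
    let T1 : topologicalType := Topological.Pack tau1 in
    let T2 : topologicalType := Topological.Pack tau2 in
    [/\ finer tau1, finer tau2, polish R T1, polish R T2 &
        @closed (T1 * T2)%type D].

Definition rect_reducible (Z1 Z2 Z1' Z2' : topologicalType)
    (A : set (Z1 * Z2)) (A' : set (Z1' * Z2')) : Prop :=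
  exists (u : Z1 -> Z1') (v : Z2 -> Z2'),
    [/\ continuous u, continuous v &
        A = (fun z : Z1 * Z2 => (u z.1, v z.2)) @^-1` A'].

(* The values of [pmap f] outside of [pdom f] are irrelevant. *)
Record partial_map (X : Type) := PartialMap {
  pdom : set X;
  pmap : X -> X
}.

Definition pran (X : Type) (f : partial_map X) : set X := pmap f @` pdom f.

Definition pgraph (X : Type) (f : partial_map X) : set (X * X) :=
  [set p | pdom f p.1 /\ pmap f p.1 = p.2].

Definition union_graph (X : Type) (f : nat -> partial_map X) : set (X * X) :=
  \bigcup_n pgraph (f n).

Definition partial_homeo (X : topologicalType) (f : partial_map X) : Prop :=
  {within pdom f, continuous (pmap f)} /\
  (exists2 g : X -> X,
     {in pdom f, cancel (pmap f) g} & {within pran f, continuous g}).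

(* The restriction of f to the intersection of B and f^-1(B), as a partial map
   of the type of elements of B. *)
Definition prestrict (X : choiceType) (B : set X) (f : partial_map X) :
    partial_map B :=
  PartialMap [set x : B | pdom f (val x) /\ B (pmap f (val x))]
             (fun x : B => insubd x (pmap f (val x))).

Definition trace_square (X : Type) (B : set X) (E : set (X * X)) :
    set (B * B) :=
  [set p | E (set_val p.1, set_val p.2)].
Arguments trace_square {X} B E _.

Definition converging_situation (R : realType) (X : topologicalType)
    (f : nat -> partial_map X) : Prop :=
  [/\ [set: X] !=set0 /\ polish R X,
      clopen_basis X,
      perfect_set [set: X],
      forall n, [/\ partial_homeo (f n), clopen (pdom (f n)) &
                    clopen (pran (f n))] &
      [set p : X * X | p.1 = p.2] =
        closure (union_graph f) `\` union_graph f].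

Definition exactly_one (P Q : Prop) : Prop := (P \/ Q) /\ ~ (P /\ Q).

(* Main.v *)
Require Import Defs.
From HB Require Import structures.
From mathcomp Require Import all_boot all_order all_algebra.
From mathcomp Require Import all_classical all_reals all_analysis.
From mathcomp Require Import ring lra zify.

Set Implicit Arguments.
Unset Strict Implicit.
Unset Printing Implicit Defensive.

Import Order.TTheory GRing.Theory Num.Theory.

Local Open Scope classical_set_scope.

                       

Local Open Scope ring_scope.

(** Let [u], [v] reduce [A] to the graph of [f], let [E0] be the closed set of pairs [(y, y')] with
    [u y = v y'], and let [w] send a pair to [u y], which on [E0] is the common value. Since the
    closure of the graph adds only the diagonal, only points of [E0] can keep [A] from being closed.
    Call a subset of [X] independent if no edge of the graph has both ends in it.

    If countably many Borel independent sets cover the image of [E0] under [w], finer Polish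
    topologies that make their preimages open make [A] closed ([potentially_closed_of_small]).

    Otherwise the argument follows the dichotomy of Kechris, Solecki and Todorcevic for Borel
    colourings. Families of configurations of 2^n points of [E0] that no countable union of Borel
    independent sets can hit are doubled along an edge ([dbl_good], which rests on Lusin separation)
    and shrunk ([good_refine]). The fusion [scheme_limit] yields a continuous [phi] from Cantor
    space into [E0] and a continuous left inverse [r] of [h = w \o phi], such that [h] maps the
    edges of the graph G_0 to edges. Pulled back along [h], the partial homeomorphisms only have
    closed domains. Removing countably many closed nowhere dense sets leaves a dense G-delta set on
    which the domains are clopen and near each point of which edges survive ([cleaning]). The image
    of this set, with the transported topology, is [B] ([converging_restriction]), and the two
    coordinates of [phi \o r] reduce the trace of the graph on [B] to [A].

    The two cases exclude each other by category ([not_potentially_closed]). If both held, [B] would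
    carry a Polish topology, finer than its own, in which every point has a neighbourhood without
    edges. But near a generic point a finer Polish topology does not distinguish generic points from
    those close in the coarse one, and coarse open sets contain edges with generic ends.

    Polish topologies are handled as complete metrics on bare types, so that several of them can
    live on one set. *)

Lemma ex_choice (X Y : Type) (P : X -> Y -> Prop) :
  (forall x, exists y, P x y) -> exists f, forall x, P x (f x).
Proof. by move=> /choice[f Hf]; exists f. Qed.

(** * Complete separable metrics on bare types *)

Section HalfPower.
Variable R : realType.

Definition hf (n : nat) : R := 2^-1 ^+ n.

Lemma hf_gt0 n : 0 < hf n.
Proof. by rewrite exprn_gt0 // invr_gt0. Qed.

Lemma hfS n : hf n = hf n.+1 + hf n.+1.
Proof. by rewrite /hf exprS; lra. Qed.

Lemma hf_le m n : (m <= n)%N -> hf n <= hf m.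
Proof.
elim: n => [|n IH]; first by rewrite leqn0 => /eqP->.
rewrite leq_eqVlt => /orP[/eqP->//|/IH]; rewrite (hfS n).
by have := hf_gt0 n.+1; lra.
Qed.

Lemma hf_small (e : R) : 0 < e -> exists n, hf n < e.
Proof.
have hfn n : hf n * n.+1%:R <= 1.
  elim: n => [|n IH]; first by rewrite /hf expr0 mulr1.
  move: IH (hf_gt0 n.+1) (ler0n R n); rewrite (hfS n) -!natr1.
  by move: (hf n.+1) (n%:R) => a b; nra.
move=> e0; have [n en] : exists n, e^-1 < n.+1%:R.
  exists (Num.bound e^-1).
  by rewrite (lt_trans (archi_boundP _)) ?invr_ge0 ?ltr_nat // ltW.
have eN : 1 < e * n.+1%:R by rewrite mulrC -ltr_pdivrMr // div1r.
exists n; rewrite ltNge; apply/negP => eh; have := hfn n.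
by rewrite leNgt => /negP; apply; rewrite (lt_le_trans eN) // ler_wpM2r.
Qed.

End HalfPower.
Arguments hf {R} n.
#[local] Hint Resolve hf_gt0 : core.

                                                                           
                                                                           
(** The metric is data on a bare type, so that different Polish topologies on one carrier can be
    compared. Separability is coded by countable colourings whose classes are uniformly small: this
    makes sense on an empty carrier and passes directly to suprema, products and pullbacks along
    injections. *)
Record polmet (R : realType) (T : Type) := Polmet {
  pdist :> T -> T -> R;
  pdistxx : forall x, pdist x x = 0;
  pdist_eq0 : forall x y, pdist x y = 0 -> x = y;
  pdistC : forall x y, pdist x y = pdist y x;
  pdist_tri : forall y x z, pdist x z <= pdist x y + pdist y z;
  pdist_complete : forall x : nat -> T,
    (forall e : R, 0 < e -> exists N, forall i j, (N <= i)%N -> (N <= j)%N ->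
       pdist (x i) (x j) < e) ->
    exists l, forall e : R, 0 < e ->
      exists N, forall i, (N <= i)%N -> pdist (x i) l < e;
  pdist_color : forall e : R, 0 < e ->
    exists c : T -> nat, forall x y, c x = c y -> pdist x y < e
}.

Section PolmetTheory.
Variables (R : realType) (T : Type).
Implicit Types (d : polmet R T) (U : set T).

Lemma pdist_ge0 d x y : 0 <= d x y.
Proof.
by have := pdist_tri d y x x; rewrite pdistxx (pdistC d y x); lra.
Qed.

Lemma pdist_triC d y x z : d x z <= d y x + d y z.
Proof. by rewrite (pdistC d y x) pdist_tri. Qed.

Lemma pdist_neq d x y : x <> y -> 0 < d x y.
Proof.
move=> xy; rewrite lt_neqAle pdist_ge0 andbT eq_sym; apply/eqP.
by move=> dxy; apply: xy; apply: (@pdist_eq0 _ _ d).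
Qed.

Definition dopen d : set (set T) :=
  [set U | forall x, U x -> exists2 e, 0 < e & forall y, d x y < e -> U y].

Lemma dopen_ball d x e : dopen d [set y | d x y < e].
Proof.
move=> y /= xy; exists (e - d x y); first lra.
by move=> z yz; have := pdist_tri d y x z; lra.
Qed.

Lemma dopenI d U V : dopen d U -> dopen d V -> dopen d (U `&` V).
Proof.
move=> oU oV x [/oU[e e0 He] /oV[e' e'0 He']].
exists (Num.min e e'); first by rewrite lt_min e0.
by move=> y; rewrite lt_min => /andP[/He ? /He'].
Qed.

Lemma dopen_bigcup d I (D : set I) (U : I -> set T) :
  (forall i, D i -> dopen d (U i)) -> dopen d (\bigcup_(i in D) U i).
Proof.
move=> oU x [i Di /(oU i Di)[e e0 He]]; exists e => // y /He ?.
by exists i.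
Qed.

Definition dborel d (E : set T) := <<s dopen d >> E.

Definition dfiner d d' := dopen d `<=` dopen d'.

Lemma dfinerP d d' : dfiner d d' <->
  forall x e, 0 < e -> exists2 a, 0 < a & forall y, d' x y < a -> d x y < e.
Proof.
split=> [H x e e0|H U oU x /oU[e e0 He]].
  have /= := H _ (@dopen_ball d x e) x; rewrite pdistxx => /(_ e0)[a a0 Ha].
  by exists a.
by have [a a0 Ha] := H x e e0; exists a => // y /Ha/He.
Qed.

Lemma dfiner_refl d : dfiner d d. Proof. by []. Qed.

Lemma dborelC d E : dborel d E -> dborel d (~` E).
Proof. by rewrite -setTD; apply: sigma_algebraCD. Qed.

Lemma dborel_bigcup d (E : nat -> set T) :
  (forall i, dborel d (E i)) -> dborel d (\bigcup_i E i).
Proof. exact: sigma_algebra_bigcup. Qed.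

Lemma dborel_open d E : dopen d E -> dborel d E.
Proof. exact: sub_sigma_algebra. Qed.

Lemma dborel_bigcap d (E : nat -> set T) :
  (forall i, dborel d (E i)) -> dborel d (\bigcap_i E i).
Proof.
move=> bE; rewrite -[X in dborel d X]setCK setC_bigcap.
by apply: dborelC; apply: dborel_bigcup => i; apply: dborelC.
Qed.

Lemma dborelI d E F : dborel d E -> dborel d F -> dborel d (E `&` F).
Proof.
move=> bE bF; rewrite -bigcap2E; apply: dborel_bigcap => -[|[|n]] //=.
by apply: dborel_open => x _; exists 1.
Qed.

Lemma dborelT d : dborel d setT.
Proof. by apply: dborel_open => x _; exists 1. Qed.

Lemma dborel0 d : dborel d set0.
Proof. by rewrite -setCT; apply: dborelC; apply: dborelT. Qed.

End PolmetTheory.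
#[local] Hint Resolve pdist_ge0 pdistxx : core.

Definition dcont (R : realType) (T S : Type) (d : polmet R T) (d' : polmet R S)
    (p : T -> S) :=
  forall x e, 0 < e -> exists2 a, 0 < a & forall y, d x y < a -> d' (p x) (p y) < e.

Section Continuity.
Variables (R : realType) (T S : Type) (d : polmet R T) (d' : polmet R S).

Lemma dcontP (p : T -> S) :
  dcont d d' p <-> forall U, dopen d' U -> dopen d (p @^-1` U).
Proof.
split=> [H U oU x /oU[e e0 He]|H x e e0].
  by have [a a0 Ha] := H x e e0; exists a => // y /Ha/He.
have /= := H _ (@dopen_ball _ _ d' (p x) e) x.
by rewrite /preimage /= pdistxx => /(_ e0).
Qed.

Lemma dborel_preimage (p : T -> S) E :
  dcont d d' p -> dborel d' E -> dborel d (p @^-1` E).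
Proof.
move=> /dcontP cp.
suff : <<s dopen d' >> `<=` [set E | dborel d (p @^-1` E)] by apply.
apply: smallest_sub => [|U oU]; last by apply: dborel_open; apply: cp.
split=> /=.
- by rewrite preimage_set0; apply: dborel0.
- by move=> A bA; rewrite /= setTD preimage_setC; apply: dborelC.
- by move=> A bA; rewrite /= preimage_bigcup; apply: dborel_bigcup.
Qed.

End Continuity.

Lemma dcont_comp (R : realType) (T S Q : Type) (d : polmet R T)
    (d' : polmet R S) (d'' : polmet R Q) (p : T -> S) (q : S -> Q) :
  dcont d d' p -> dcont d' d'' q -> dcont d d'' (q \o p).
Proof.
move=> cp cq x e /(cq (p x))[a /(cp x)[b b0 Hb] Ha].
by exists b => // y /Hb/Ha.
Qed.

Lemma dcont_id (R : realType) (T : Type) (d : polmet R T) : dcont d d id.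
Proof. by move=> x e e0; exists e. Qed.

Lemma dopen_neq (R : realType) (T S : Type) (d : polmet R T) (d' : polmet R S)
    (p q : T -> S) : dcont d d' p -> dcont d d' q -> dopen d [set z | p z <> q z].
Proof.
move=> cp cq z /= pq.
have e0 : 0 < d' (p z) (q z) / 2 by have := pdist_neq d' pq; lra.
have [a a0 Ha] := cp z _ e0; have [b b0 Hb] := cq z _ e0.
exists (Num.min a b); first by rewrite lt_min a0.
move=> y; rewrite lt_min => /andP[/Ha h1 /Hb h2] py.
move: h1 h2; rewrite py (pdistC d' (q z)).
by have := pdist_tri d' (q y) (p z) (q z); lra.
Qed.

(** * Translation between Polish spaces and metrics on types *)

Section Bridge.
Variable R : realType.

(** Sequential completeness comes from filter completeness applied to the filter of tails. A point
    is coloured by the index of a nearby term of the dense sequence. *)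
Lemma polish_polmet (T : topologicalType) : polish R T ->
  exists d : polmet R T, forall U : set T, open U <-> dopen d U.
Proof.
move=> [[D cD dD] [m /= [opE cplt]]]; set M := Metric.Pack m in opE cplt.
pose d : M -> M -> R := @mdist R M.
have ballE x e : ball x e = [set y : M | d x y < e] by exact: ballEmdist.
have opM (U : set T) : open U <-> forall x : M, U x -> exists2 e : R, 0 < e & forall y : M, d x y < e -> U y.
  rewrite opE openE; split=> oU x /oU.
    move=> /nbhs_ballP[e /= e0 He]; exists e => // y xy; apply: He.
    by rewrite ballE.
  by move=> [e e0 He]; apply/nbhs_ballP; exists e => //= y; rewrite ballE => /He.
have compl (x : nat -> M) :
    (forall e : R, 0 < e -> exists N, forall i j, (N <= i)%N -> (N <= j)%N ->
       d (x i) (x j) < e) ->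
    exists l, forall e : R, 0 < e -> exists N, forall i, (N <= i)%N -> d (x i) l < e.
  move=> cx; have [] := cplt (x @ \oo).
    apply/cauchy_ballP => e e0; have [N HN] := cx e e0.
    exists (x @` [set i | (N <= i)%N], x @` [set i | (N <= i)%N]).
      by split=> /=; exists N => // i /= Ni; exists i.
    move=> [a b] /= [[i /= Ni <-] [j /= Nj <-]].
    by rewrite ballE; apply: HN.
  move=> l xl; exists l => e e0.
  have [N _ HN] := xl _ (@nbhsx_ballx R M l e e0).
  exists N => i Ni; have := HN i Ni.
  by rewrite /= ballE /= /d metric_sym.
have col (e : R) : 0 < e -> exists c : M -> nat, forall x y, c x = c y -> d x y < e.
  move=> e0; have [/pfcard_geP[D0|[s]]] := cD.
    (* An empty dense set forces the space to be empty, so any colouring will do. *)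
    exists (fun _ => 0%N) => x y _; exfalso.
    have [] := dD [set: T]; first by exists x.
      exact: openT.
    by move=> z [_]; rewrite D0.
  have near (x : M) : exists n, d (s n) x < e / 2.
    have [||z [xz Dz]] := dD [set y : M | d x y < e / 2].
    - by exists x; rewrite /= /d mdistxx; lra.
    - apply/opM => y /= xy; exists (e / 2 - d x y); first lra.
      by move=> z; rewrite /d in xy *; have := metric_triangle x y z; lra.
    have [n _ sn] := @surj _ _ _ _ s z Dz; exists n.
    by rewrite /d metric_sym sn.
  have [c Hc] := choice near; exists c => x y cxy.
  have := metric_triangle x (s (c x) : M) y.
  have := Hc x; have := Hc y; rewrite cxy /d (metric_sym (s (c y) : M) x).
  lra.
by exists (@Polmet R T d (@mdistxx R M) (@mdist_positivity R M) (@metric_sym R M)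
  (fun y x z => @metric_triangle R M x y z) compl col).
Qed.

End Bridge.

(** The metric is a parameter of this copy of [T], so that each [d] induces its own canonical
    topology on the same carrier. *)
Definition metrized (R : realType) (T : choiceType) (d : polmet R T) : Type := T.

HB.instance Definition _ (R : realType) (T : choiceType) (d : polmet R T) :=
  Choice.on (metrized d).

HB.instance Definition _ (R : realType) (T : choiceType) (d : polmet R T) :=
  @isMetric.Build R (metrized d) (pdist d) (pdistxx d) (@pdist_eq0 _ _ d)
    (pdistC d) (pdist_tri d).

Section PolishOfPolmet.
Variable R : realType.

Lemma metrized_open (T : choiceType) (d : polmet R T) (U : set T) :
  @open (metrized d) U <-> dopen d U.
Proof.
rewrite openE; split=> oU x /oU.
  by move=> /(@nbhs_ballP R (metrized d))[e /= e0 He]; exists e.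
by move=> [e e0 He]; apply/(@nbhs_ballP R (metrized d)); exists e.
Qed.

(** One point chosen in each nonempty colour class gives a countable dense set. A Cauchy filter is
    followed by a sequence whose n-th term lies in [A 0], ..., [A n], where [A i] is a member of the
    filter of diameter at most [hf i]. *)
Lemma polmet_polish (T : topologicalType) (d : polmet R T) :
  (forall U : set T, open U <-> dopen d U) -> polish R T.
Proof.
move=> opE; split.
  have [c Hc] := ex_choice (fun n => pdist_color d (hf_gt0 R n)).
  have [p Hp] : exists p : nat * nat -> option T, forall k,
      match p k with Some x => c k.1 x = k.2
                   | None => forall x, c k.1 x <> k.2 end.
    apply: (@ex_choice _ _ (fun k o => match o with Some x => c k.1 x = k.2
                   | None => forall x, c k.1 x <> k.2 end)) => k.
    have [[x xk]|nx] := pselect (exists x, c k.1 x = k.2).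
      by exists (Some x).
    by exists None => x xk; apply: nx; exists x.
  exists [set x | exists k, p k = Some x].
    apply/countable_injP.
    have [q Hq] : exists q : T -> nat * nat, forall x, (exists k, p k = Some x) -> p (q x) = Some x.
      apply: (@ex_choice _ _ (fun x k => (exists k, p k = Some x) -> p k = Some x)) => x.
      have [[k xk]|nx] := pselect (exists k, p k = Some x).
        by exists k.
      by exists (0%N, 0%N).
    exists (pickle \o q) => x y; rewrite !inE /= => /Hq xk /Hq yk.
    move=> /(pcan_inj (@pickleK _)) qxy.
    by move: xk; rewrite qxy yk => -[].
  move=> U [x Ux] /opE/(_ x Ux)[e e0 He].
  have [n ne] := hf_small e0; have := Hp (n, c n x).
  case E : (p (n, c n x)) => [y|] /= Hy; last by case: (Hy x).
  exists y; split; last by exists (n, c n x).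
  by apply: He; apply: lt_trans ne; apply: Hc.
exists (Metric.class (metrized d)); split => [U|F PF cF].
  by rewrite opE; apply: iff_sym; apply: metrized_open.
pose M := metrized d.
have ex n : exists A : set M, F A /\ forall x y, A x -> A y -> d x y < hf n.
  move/(@cauchy_ballP R M F): cF => /(_ (hf n) (hf_gt0 R n))[[A B] /= [FA FB] AB].
  exists (A `&` B); split; first exact: filterI.
  by move=> x y [Ax _] [_ By]; apply: (AB (x, y)).
have [A HA] := choice ex.
have [x Hx] : exists x : nat -> M, forall n, forall i, (i <= n)%N -> A i (x n).
  apply: (@ex_choice _ _ (fun n x => forall i, (i <= n)%N -> A i x)) => n.
  apply: (@filter_ex _ F).
  elim: n => [|n IH].
    by apply: filterS (HA 0%N).1 => x Ax i; rewrite leqn0 => /eqP->.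
  apply: filterS2 (HA n.+1).1 IH => x Ax IH i.
  by rewrite leq_eqVlt => /orP[/eqP->|/IH].
have [|l Hl] := @pdist_complete _ _ d x.
  move=> e e0; have [N Ne] := hf_small e0; exists N => i j Ni Nj.
  by apply: lt_trans Ne; apply: (HA N).2; [exact: Hx | exact: Hx].
exists (l : M) => U /(@nbhs_ballP R M)[e /= e0 He].
have [N Ne] : exists N, (hf N : R) < e / 2 by apply: hf_small; lra.
have [|K HK] := Hl (e / 2); first by lra.
apply: filterS (HA N).1 => y Ay; apply: He; change (d l y < e).
have xN : d (x (maxn N K)) y < hf N.
  by apply: (HA N).2 => //; apply: Hx; rewrite leq_maxl.
have := HK (maxn N K) (leq_maxr _ _);
have := pdist_triC d (x (maxn N K)) l y; lra.
Qed.

End PolishOfPolmet.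

(** * Countable suprema and products of metrics *)

Section SupPolmet.
Variables (R : realType) (T : Type) (P : nat -> T -> T -> R).
Hypothesis Pxx : forall n x, P n x x = 0.
Hypothesis PC : forall n x y, P n x y = P n y x.
Hypothesis Ptri : forall n y x z, P n x z <= P n x y + P n y z.
Hypothesis Psep : forall x y, (forall n, P n x y = 0) -> x = y.
Hypothesis Pcomplete : forall x : nat -> T,
  (forall n (e : R), 0 < e -> exists N, forall i j, (N <= i)%N -> (N <= j)%N ->
     P n (x i) (x j) < e) ->
  exists l, forall n (e : R), 0 < e ->
    exists N, forall i, (N <= i)%N -> P n (x i) l < e.
Hypothesis Pcolor : forall n (e : R), 0 < e ->
  exists c : T -> nat, forall x y, c x = c y -> P n x y < e.

(** The distance is the supremum over n of min(2^-n, [P n x y]), a metric for the join of the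
    topologies of the pseudometrics [P n]. The cut-off at 2^-n leaves only finitely many indices to
    control at each precision. *)
Let S x y := [set z : R | exists n, z = Num.min (hf n) (P n x y)].
Let D x y := sup (S x y).

Let Pge0 n x y : 0 <= P n x y.
Proof. by have := Ptri n y x x; rewrite Pxx (PC n y x); lra. Qed.

Let S0 x y : S x y !=set0.
Proof. by exists (Num.min (hf 0) (P 0 x y)); exists 0%N. Qed.

Let SD n x y : Num.min (hf n) (P n x y) <= D x y.
Proof.
apply: ub_le_sup; last by exists n.
exists 1 => _ [m ->]; rewrite ge_min; apply/orP; left.
by rewrite (le_trans (hf_le R (leq0n m))) // /hf expr0.
Qed.

Let DleP x y M : (forall n, Num.min (hf n) (P n x y) <= M) -> D x y <= M.
Proof. by move=> H; apply: ge_sup (S0 x y) _ => _ [n ->]. Qed.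

Let DA n x y : D x y < hf n -> P n x y <= D x y.
Proof.
have := SD n x y; rewrite ge_min => /orP[|//].
by move=> h1 h2; exfalso; move: (le_lt_trans h1 h2); rewrite ltxx.
Qed.

Let DB N x y : (forall n, (n < N)%N -> P n x y <= hf N) -> D x y <= hf N.
Proof.
move=> H; apply: DleP => n; rewrite ge_min.
by have [/H ->|/hf_le ->] := ltnP n N; rewrite ?orbT.
Qed.

Let Dge0 x y : 0 <= D x y.
Proof. by apply: le_trans (SD 0 x y); rewrite le_min Pge0 ltW. Qed.

Let Dxx x : D x x = 0.
Proof.
apply/eqP; rewrite eq_le Dge0 andbT; apply: DleP => n.
by rewrite Pxx ge_min lexx orbT.
Qed.

Let DC x y : D x y = D y x.
Proof.
by rewrite /D; congr sup; apply/seteqP; split=> z [n ->]; exists n; rewrite PC.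
Qed.

Let Dtri y x z : D x z <= D x y + D y z.
Proof.
apply: DleP => n; apply: le_trans (lerD (SD n x y) (SD n y z)).
have := Ptri n y x z; have := hf_gt0 R n; have := Pge0 n x y.
have := Pge0 n y z; rewrite ge_min.
case: (leP (hf n) (P n x y)) => ?; case: (leP (hf n) (P n y z)) => ? ? ? ? ?;
  apply/orP; solve [left; lra | right; lra].
Qed.

Let Deq0 x y : D x y = 0 -> x = y.
Proof.
move=> xy; apply: Psep => n; apply/eqP; rewrite eq_le Pge0 andbT -xy.
by apply: DA; rewrite xy hf_gt0.
Qed.

Let DAu n (e : R) : 0 < e -> exists2 a : R, 0 < a & forall x y, D x y < a -> P n x y < e.
Proof.
move=> e0; exists (Num.min e (hf n)); first by rewrite lt_min e0 hf_gt0.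
move=> x y; rewrite lt_min => /andP[xe xn].
exact: le_lt_trans (DA xn) xe.
Qed.

Let DBu (e : R) : 0 < e -> exists N, exists2 a : R, 0 < a &
  forall x y, (forall n, (n < N)%N -> P n x y < a) -> D x y < e.
Proof.
move=> /hf_small[N Ne]; exists N, (hf N) => // x y H.
by apply: le_lt_trans Ne; apply: DB => n /H/ltW.
Qed.

Let eventually_all (Q : nat -> nat -> Prop) N :
  (forall n, (n < N)%N -> exists K, forall i, (K <= i)%N -> Q n i) ->
  exists K, forall i, (K <= i)%N -> forall n, (n < N)%N -> Q n i.
Proof.
elim: N => [|N IH] H; first by exists 0%N.
have [|K HK] := IH; first by move=> n nN; apply: H; rewrite ltnS ltnW.
have [K' HK'] := H N (ltnSn N); exists (maxn K K') => i.
rewrite geq_max => /andP[Ki K'i] n; rewrite ltnS leq_eqVlt.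
by move=> /orP[/eqP->|]; [exact: HK' | exact: HK].
Qed.

Let Dcomplete (x : nat -> T) :
  (forall e : R, 0 < e -> exists N, forall i j, (N <= i)%N -> (N <= j)%N ->
     D (x i) (x j) < e) ->
  exists l, forall e : R, 0 < e ->
    exists N, forall i, (N <= i)%N -> D (x i) l < e.
Proof.
move=> cx; have [|l Hl] := @Pcomplete x.
  move=> n e /(DAu n)[a /cx[N HN] Ha]; exists N => i j Ni Nj.
  exact: Ha (HN _ _ Ni Nj).
exists l => e /DBu[N [a a0 Ha]].
have [K HK] := @eventually_all (fun n i => P n (x i) l < a) N (fun n _ => Hl n a a0).
by exists K => i Ki; apply: Ha => n; apply: HK.
Qed.

Let Dcolor (e : R) : 0 < e -> exists c : T -> nat, forall x y, c x = c y -> D x y < e.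
Proof.
move=> /DBu[N [a a0 Ha]]; have [c Hc] := ex_choice (fun n => Pcolor n a0).
exists (fun x => pickle [seq c n x | n <- iota 0 N]) => x y.
move=> /(pcan_inj (@pickleK _)) cxy; apply: Ha => n nN; apply: Hc.
have := congr1 (fun s => nth 0%N s n) cxy.
by rewrite !(nth_map 0%N) ?size_iota // nth_iota.
Qed.

(** The formula stays hidden: all later arguments go through these two uniform comparisons. *)
Lemma sup_polmet : exists d : polmet R T,
  (forall n (e : R), 0 < e ->
     exists2 a : R, 0 < a & forall x y, d x y < a -> P n x y < e) /\
  (forall e : R, 0 < e -> exists N, exists2 a : R, 0 < a &
     forall x y, (forall n, (n < N)%N -> P n x y < a) -> d x y < e).
Proof.
by exists (@Polmet R T D Dxx Deq0 DC Dtri Dcomplete Dcolor).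
Qed.

End SupPolmet.

Section ProdPolmet.
Variables (R : realType) (T S : Type) (d : polmet R T) (d' : polmet R S).

Let D (p q : T * S) := d p.1 q.1 + d' p.2 q.2.

Let Dxx p : D p p = 0. Proof. by rewrite /D !pdistxx addr0. Qed.
Let Deq0 p q : D p q = 0 -> p = q.
Proof.
case: p q => [a b] [a' b']; rewrite /D /= => h.
have := pdist_ge0 d a a'; have := pdist_ge0 d' b b' => h1 h2.
by congr pair; [apply: (@pdist_eq0 _ _ d) | apply: (@pdist_eq0 _ _ d')]; lra.
Qed.
Let DC p q : D p q = D q p.
Proof. by rewrite /D pdistC (pdistC d'). Qed.
Let Dtri q p r : D p r <= D p q + D q r.
Proof.
by have := pdist_tri d q.1 p.1 r.1; have := pdist_tri d' q.2 p.2 r.2; rewrite /D; lra.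
Qed.
Let Dcomplete (x : nat -> T * S) :
  (forall e : R, 0 < e -> exists N, forall i j, (N <= i)%N -> (N <= j)%N ->
     D (x i) (x j) < e) ->
  exists l, forall e : R, 0 < e ->
    exists N, forall i, (N <= i)%N -> D (x i) l < e.
Proof.
move=> cx; have [|l1 H1] := @pdist_complete _ _ d (fst \o x).
  move=> e /cx[N HN]; exists N => i j Ni Nj; have := HN i j Ni Nj.
  by have := pdist_ge0 d' (x i).2 (x j).2; rewrite /D /=; lra.
have [|l2 H2] := @pdist_complete _ _ d' (snd \o x).
  move=> e /cx[N HN]; exists N => i j Ni Nj; have := HN i j Ni Nj.
  by have := pdist_ge0 d (x i).1 (x j).1; rewrite /D /=; lra.
exists (l1, l2) => e e0; have e2 : 0 < e / 2 by lra.
have [N HN] := H1 _ e2; have [K HK] := H2 _ e2.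
exists (maxn N K) => i; rewrite geq_max => /andP[/HN h1 /HK h2].
by move: h1 h2; rewrite /D /=; lra.
Qed.
Let Dcolor (e : R) : 0 < e -> exists c : T * S -> nat, forall x y, c x = c y -> D x y < e.
Proof.
move=> e0; have e2 : 0 < e / 2 by lra.
have [c Hc] := pdist_color d e2; have [c' Hc'] := pdist_color d' e2.
exists (fun p => pickle (c p.1, c' p.2)) => p q /(pcan_inj (@pickleK _))[h h'].
by have := Hc _ _ h; have := Hc' _ _ h'; rewrite /D; lra.
Qed.

Definition prod_polmet : polmet R (T * S) :=
  @Polmet R (T * S) D Dxx Deq0 DC Dtri Dcomplete Dcolor.

Lemma prod_polmetE p q : prod_polmet p q = d p.1 q.1 + d' p.2 q.2.
Proof. by []. Qed.

Lemma dcont_fst : dcont prod_polmet d fst.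
Proof.
move=> p e e0; exists e => // q; rewrite prod_polmetE.
by have := pdist_ge0 d' p.2 q.2; lra.
Qed.

Lemma dcont_snd : dcont prod_polmet d' snd.
Proof.
move=> p e e0; exists e => // q; rewrite prod_polmetE.
by have := pdist_ge0 d p.1 q.1; lra.
Qed.

End ProdPolmet.

(** * Finer Polish topologies that make Borel sets clopen *)

Section Refinement.
Variables (R : realType) (T : Type).
Implicit Types (d : polmet R T) (U : set T).

Lemma finer_limit d d' (x : nat -> T) l : dfiner d d' ->
  (forall e : R, 0 < e -> exists N, forall i, (N <= i)%N -> d' (x i) l < e) ->
  (forall e : R, 0 < e -> exists N, forall i, (N <= i)%N -> d (x i) l < e).
Proof.
move=> /dfinerP fdd' xl e /(fdd' l)[a /xl[N HN] Ha]; exists N => i /HN.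
by rewrite pdistC => /Ha; rewrite pdistC.
Qed.

Lemma limit_unique d (x : nat -> T) l l' :
  (forall e : R, 0 < e -> exists N, forall i, (N <= i)%N -> d (x i) l < e) ->
  (forall e : R, 0 < e -> exists N, forall i, (N <= i)%N -> d (x i) l' < e) ->
  l = l'.
Proof.
move=> xl xl'; have [//|/(pdist_neq d) ll'] := pselect (l = l').
have e0 : 0 < d l l' / 2 by lra.
have [N HN] := xl _ e0; have [N' HN'] := xl' _ e0.
have := HN _ (leq_maxl N N'); have := HN' _ (leq_maxr N N').
have := pdist_triC d (x (maxn N N')) l l' => *; exfalso; lra.
Qed.

(** Joint completeness holds because the limits taken in the various [D n] are all limits in the
    coarser [d], hence equal. The last clause records that the supremum changes nothing at a point
    where no [D n] does. *)
Lemma dfiner_sup d (D : nat -> polmet R T) : (forall n, dfiner d (D n)) ->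
  exists d', [/\ dfiner d d', forall n, dfiner (D n) d' &
    forall x, (forall n (e : R), 0 < e ->
        exists2 a : R, 0 < a & forall y, d x y < a -> D n x y < e) ->
      forall e : R, 0 < e ->
        exists2 a : R, 0 < a & forall y, d x y < a -> d' x y < e].
Proof.
move=> fD; have [||||||d' [A B]] := @sup_polmet R T (fun n => D n).
- by move=> n x; apply: pdistxx.
- by move=> n x y; apply: pdistC.
- by move=> n y x z; apply: pdist_tri.
- by move=> x y xy; apply: pdist_eq0 (xy 0%N).
- move=> x cx; have [l Hl] := ex_choice (fun n => @pdist_complete _ _ (D n) x (cx n)).
  exists (l 0%N) => n; suff -> : l 0%N = l n by apply: Hl.
  by apply: (@limit_unique d x); apply: finer_limit (fD _) (Hl _).
- by move=> n e e0; apply: pdist_color.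
have fDn n : dfiner (D n) d'.
  by apply/dfinerP => x e /(A n)[a a0 Ha]; exists a => // y /Ha.
exists d'; split => //; first by move=> U oU; apply: (fDn 0%N); apply: fD.
move=> x cx e /B[N [a a0 Ha]].
suff [b b0 Hb] : exists2 b : R, 0 < b & forall y, d x y < b -> forall n, (n < N)%N -> D n x y < a.
  by exists b => // y /Hb/Ha.
elim: N {Ha} => [|N [b b0 Hb]]; first by exists 1.
have [b' b'0 Hb'] := cx N a a0; exists (Num.min b b'); first by rewrite lt_min b0.
move=> y; rewrite lt_min => /andP[/Hb yb /Hb' yb'] n.
by rewrite ltnS leq_eqVlt => /orP[/eqP->|/yb].
Qed.

                                                                             
                                             
(** To [d] is added the pseudometric [|phi x - phi y|], where [phi] vanishes off [U] and blows up at
    the boundary of [U] from inside. The gap in the values of [phi] makes [U] clopen, and the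
    blow-up prevents a Cauchy sequence in [U] from converging to a point outside. On [U] the
    function [phi] is continuous, so the topology is unchanged there. *)
Lemma dfiner_clopen d U : dopen d U ->
  exists d', [/\ dfiner d d', dopen d' U, dopen d' (~` U) &
    forall x, U x -> forall e : R, 0 < e ->
        exists2 a : R, 0 < a & forall y, d x y < a -> d' x y < e].
Proof.
move=> oU.
(* [rho] is the distance to the complement of [U], cut off at 1. As a supremum of radii of balls
   inside [U] it needs no special case when [U] is the whole space. *)
pose S x := [set e : R | 0 <= e <= 1 /\ forall y, d x y < e -> U y].
pose rho x := sup (S x).
have S0 x : S x 0 by split; [rewrite lexx ler01|move=> y; have := pdist_ge0 d x y; lra].
have Sub x : has_ubound (S x) by exists 1 => e [/andP[]].
have rho_ge0 x : 0 <= rho x by apply: ub_le_sup.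
have rho_gt0 x : U x -> 0 < rho x.
  move=> /oU[e e0 He]; apply: (@lt_le_trans _ _ (Num.min e 1)).
    by rewrite lt_min e0 ltr01.
  apply: ub_le_sup => //; split; first by rewrite le_min ltW //= ler01 ge_min lexx orbT.
  by move=> y; rewrite lt_min => /andP[/He].
have rho_U x : 0 < rho x -> U x.
  move=> r0; have [|e [_ He] e0] := @sup_gt _ (S x) 0 _ r0; first by exists 0.
  by apply: He; rewrite pdistxx.
have rho_lip x y : rho x <= rho y + d x y.
  apply: ge_sup; first by exists 0.
  move=> e [/andP[e0 e1] He]; rewrite -lerBlDr.
  have [h|h] := lerP (e - d x y) 0; first exact: le_trans h _.
  apply: ub_le_sup => //; split; first by have := pdist_ge0 d x y; lra.
  by move=> z yz; apply: He; have := pdist_tri d y x z; lra.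
(* The summand 1 separates the values on [U], all at least 1, from the value 0 off [U]. *)
pose phi x := if pselect (U x) then 1 + (rho x)^-1 else 0.
have phiU x : U x -> phi x = 1 + (rho x)^-1 by rewrite /phi; case: pselect.
have phiNU x : ~ U x -> phi x = 0 by rewrite /phi; case: pselect.
have phi_ge1 x : U x -> 1 <= phi x.
  by move=> Ux; rewrite phiU // lerDl invr_ge0.
have phi_cont x : U x -> forall e : R, 0 < e ->
    exists2 a : R, 0 < a & forall y, d x y < a -> `|phi x - phi y| < e.
  move=> Ux e e0; have [a a0 Ha] := oU x Ux; have r0 := rho_gt0 x Ux.
  set r := rho x in r0.
  have er : 0 < e * (r * r) / 2 by rewrite divr_gt0 // !mulr_gt0.
  exists (Num.min a (Num.min (r / 2) (e * (r * r) / 2))).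
    by rewrite !lt_min a0 er divr_gt0.
  move=> y; rewrite !lt_min => /andP[/Ha Uy /andP[xr xe]].
  have ry := rho_gt0 y Uy; rewrite !phiU // -/r.
  have h1 := rho_lip x y; have h2 := rho_lip y x; rewrite (pdistC d y x) -/r in h1 h2.
  set s := rho y in ry h1 h2 *.
  have sr : r / 2 < s by lra.
  have -> : 1 + r^-1 - (1 + s^-1) = (s - r) / (r * s).
    by field; rewrite !gt_eqF.
  rewrite normrM normfV (gtr0_norm (mulr_gt0 r0 ry)) ltr_pdivrMr ?mulr_gt0 //.
  have : `|s - r| <= d x y by rewrite ler_norml; lra.
  have : e * (r * r) / 2 < e * (r * s).
    rewrite -mulrA ltr_pM2l // -mulrA ltr_pM2l //.
  lra.
have [||||||d' [A B]] := @sup_polmet R T (fun n x y => if n is 0%N then d x y else `|phi x - phi y|).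
- by move=> [|n] x; rewrite ?pdistxx // subrr normr0.
- by move=> [|n] x y; [apply: pdistC | rewrite distrC].
- by move=> [|n] y x z; [apply: pdist_tri | apply: ler_distD].
- by move=> x y xy; apply: pdist_eq0 (xy 0%N).
- move=> x cx; have [l Hl] := @pdist_complete _ _ d x (cx 0%N).
  exists l => -[|n]; first exact: Hl.
  (* Beyond [N] the values of [phi] differ by less than 1, so the tail lies entirely in [U] or
     entirely outside. *)
  have [N HN] := cx 1%N 1 ltr01.
  have same i : (N <= i)%N -> U (x i) <-> U (x N).
    move=> Ni; have := HN i N Ni (leqnn _); rewrite ltr_norml.
    have [Ui|Ui] := pselect (U (x i)); have [UN|UN] := pselect (U (x N)) => //.
      by have := phi_ge1 _ Ui; rewrite (phiNU (x N)) //; lra.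
    by have := phi_ge1 _ UN; rewrite (phiNU (x i)) //; lra.
  have [UN|UN] := pselect (U (x N)); last first.
    have Ul : ~ U l.
      move=> /oU[e /Hl[K HK] He]; apply: UN; rewrite -(same _ (leq_maxl N K)).
      by apply: He; rewrite pdistC; apply: HK; apply: leq_maxr.
    move=> e e0; exists N => i Ni; rewrite !phiNU ?subrr ?normr0 //.
    by rewrite same.
  suff Ul : U l.
    move=> e /(phi_cont l Ul)[a /Hl[K HK] Ha]; exists K => i /HK.
    by rewrite pdistC => /Ha; rewrite distrC.
  (* [M] bounds [phi] along the tail, so [rho] stays above [M^-1] there and, being 1-Lipschitz, is
     positive at the limit. *)
  pose M := phi (x N) + 1.
  have M0 : 0 < M by have := phi_ge1 _ UN; rewrite /M; lra.
  have rM i : (N <= i)%N -> M^-1 <= rho (x i).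
    move=> Ni; have Ui : U (x i) by rewrite same.
    have := HN i N Ni (leqnn _); rewrite ltr_norml => /andP[_ h].
    rewrite -[leRHS]invrK lef_pV2 ?posrE ?invr_gt0 ?rho_gt0 //.
    by move: h; rewrite (phiU (x i)) // /M; lra.
  have M2 : 0 < M^-1 / 2 by rewrite divr_gt0 // invr_gt0.
  have [K HK] := Hl _ M2; apply: rho_U.
  have := HK _ (leq_maxr N K); have := rM _ (leq_maxl N K).
  by have := rho_lip (x (maxn N K)) l; lra.
- move=> [|n] e e0; first exact: pdist_color.
  have phi_ge0 x : 0 <= phi x / e.
    rewrite divr_ge0 ?(ltW e0) //; have [Ux|Ux] := pselect (U x).
      by have := phi_ge1 x Ux; lra.
    by rewrite phiNU.
  exists (fun x => Num.trunc (phi x / e)) => x y xy.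
  have := truncn_itv (phi_ge0 x); have := truncn_itv (phi_ge0 y); rewrite xy.
  rewrite !ler_pdivlMr // !ltr_pdivrMr // -natr1 mulrDl mul1r ltr_norml.
  by move=> /andP[h1 h2] /andP[h3 h4]; lra.
have f' : dfiner d d'.
  by apply/dfinerP => x e /(A 0%N)[a a0 Ha]; exists a => // y /Ha.
exists d'; split => //.
- have [a a0 Ha] := A 1%N 1 ltr01.
  move=> x Ux; exists a => // y /Ha; rewrite ltr_norml.
  have [Uy|Uy] := pselect (U y) => //; have := phi_ge1 x Ux.
  by rewrite (phiNU y) //; lra.
- have [a a0 Ha] := A 1%N 1 ltr01.
  move=> x Ux; exists a => // y /Ha; rewrite ltr_norml => + Uy.
  by have := phi_ge1 y Uy; rewrite (phiNU x) //; lra.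
move=> x Ux e /B[N [a a0 Ha]]; have [b b0 Hb] := phi_cont x Ux a a0.
exists (Num.min a b); first by rewrite lt_min a0.
by move=> y; rewrite lt_min => /andP[xa xb]; apply: Ha => -[|n] _ //; apply: Hb.
Qed.

End Refinement.

                                                              

Section BorelRefinement.
Variables (R : realType) (T : Type).
Implicit Types (d : polmet R T) (U : set T).

(** The sets that can be made clopen form a sigma-algebra containing the open sets: for a countable
    union, take the supremum of the metrics found for the members, in which the union is open, and
    then make it clopen. *)
Lemma dfiner_borel1 d E : dborel d E ->
  exists d', [/\ dfiner d d', dopen d' E & dopen d' (~` E)].
Proof.
suff : <<s dopen d >> `<=`
  [set E | exists d', [/\ dfiner d d', dopen d' E & dopen d' (~` E)]] by apply.
apply: smallest_sub => [|U /dfiner_clopen[d' [? ? ? _]]]; last by exists d'.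
split.
- exists d; split; [exact: dfiner_refl|by move=> x []|].
  by rewrite setC0 => x _; exists 1.
- move=> A [d' [fd oA oCA]]; exists d'.
  by rewrite setTD setCK; split.
- move=> A hA; have [D HD] := ex_choice hA.
  have [n|d0 [f0 fD _]] := @dfiner_sup R T d D; first by have [] := HD n.
  have oA n : dopen d0 (A n) by apply: (fD n); have [] := HD n.
  have oU : dopen d0 (\bigcup_n A n) by apply: dopen_bigcup.
  have [d1 [f1 o1 oc1 _]] := dfiner_clopen oU.
  by exists d1; split => // V /f0/f1.
Qed.

Lemma dfiner_borel d (E : nat -> set T) : (forall n, dborel d (E n)) ->
  exists d', dfiner d d' /\ forall n, dopen d' (E n) /\ dopen d' (~` E n).
Proof.
move=> bE; have [D HD] := ex_choice (fun n => dfiner_borel1 (bE n)).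
have [n|d0 [f0 fD _]] := @dfiner_sup R T d D; first by have [] := HD n.
exists d0; split => // n.
have [_ o1 o2] := HD n; split; exact: (fD n).
Qed.

(** This is the core of the theorem that a G-delta subset of a Polish space is Polish: the set
    becomes closed, while at its own points the topology remains that of [d]. *)
Lemma dfiner_Gdelta d (O : nat -> set T) : (forall n, dopen d (O n)) ->
  exists d', [/\ dfiner d d', dopen d' (~` \bigcap_n O n) &
    forall x, (forall n, O n x) -> forall e : R, 0 < e ->
        exists2 a : R, 0 < a & forall y, d x y < a -> d' x y < e].
Proof.
move=> oO; have [D HD] := ex_choice (fun n => dfiner_clopen (oO n)).
have [n|d0 [f0 fD cD]] := @dfiner_sup R T d D; first by have [] := HD n.
exists d0; split => //.
  rewrite setC_bigcap; apply: dopen_bigcup => n _.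
  by apply: (fD n); have [] := HD n.
by move=> x Ox; apply: cD => n; have [_ _ _] := HD n; apply.
Qed.

End BorelRefinement.

(** * Lusin separation of disjoint continuous images *)

Section Separation.
Variables (R : realType) (T X : Type) (d : polmet R T) (dX : polmet R X).

Definition borel_separated (S1 S2 : set X) :=
  exists C, [/\ dborel dX C, S1 `<=` C & S2 `<=` ~` C].

Lemma borel_separated_bigcup (S1 S2 : nat -> set X) :
  (forall i j, borel_separated (S1 i) (S2 j)) ->
  borel_separated (\bigcup_i S1 i) (\bigcup_i S2 i).
Proof.
move=> H; have [C HC] := ex_choice (fun k : nat * nat => H k.1 k.2).
exists (\bigcup_i \bigcap_j C (i, j)); split.
- apply: dborel_bigcup => i; apply: dborel_bigcap => j.
  by have [] := HC (i, j).
- by move=> x [i _ Six]; exists i => // j _; have [_ + _] := HC (i, j); apply.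
- move=> x [j _ Sjx] [i _ Hi]; have [_ _ /(_ x Sjx)] := HC (i, j); apply.
  exact: Hi.
Qed.

Lemma closed_limit (E : set T) (x : nat -> T) l :
  dopen d (~` E) -> (forall n, E (x n)) ->
  (forall e : R, 0 < e -> exists N, forall i, (N <= i)%N -> d (x i) l < e) -> E l.
Proof.
move=> oE Ex xl; have [//|/oE[e /xl[N HN] He]] := pselect (E l).
by have [] := He (x N) _ (Ex N); rewrite pdistC HN.
Qed.

Lemma nested_small_limit (A : nat -> set T) (E : set T) :
  dopen d (~` E) -> (forall n, A n `<=` E) ->
  (forall n, A n.+1 `<=` A n) -> (forall n, A n !=set0) ->
  (forall n x y, A n.+1 x -> A n.+1 y -> d x y < hf n) ->
  exists l, E l /\ forall e : R, 0 < e -> exists n, forall x, A n x -> d x l < e.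
Proof.
move=> oE AE dA A0 sA; have [x Hx] := ex_choice A0.
have mA n m : (n <= m)%N -> A m `<=` A n.
  elim: m => [|m IH]; first by rewrite leqn0 => /eqP->.
  by rewrite leq_eqVlt => /orP[/eqP->//|/IH nm] z /dA/nm.
have [|l Hl] := @pdist_complete _ _ d x.
  move=> e /hf_small[N Ne]; exists N.+1 => i j Ni Nj.
  by apply: lt_trans Ne; apply: sA; apply: mA (Hx _).
exists l; split; first by apply: closed_limit oE _ Hl => n; apply: AE.
move=> e e0; have [N Ne] : exists N, (hf N : R) < e / 2 by apply: hf_small; lra.
have [|K HK] := Hl (e / 2); first by lra.
exists N.+1 => y Ay; have := HK _ (leq_maxl K N.+1).
have : d y (x (maxn K N.+1)) < hf N.
  by apply: sA => //; apply: mA (Hx _); apply: leq_maxr.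
by have := pdist_tri d (x (maxn K N.+1)) y l; lra.
Qed.

(** If the images cannot be separated, cut both sets into countably many small pieces: some pair of
    pieces still has inseparable images. Iterating, the pieces shrink to points [a] of [E] and [b]
    of [F]. As [p a] and [q b] differ, a ball around [p a] separates the images of late pieces, a
    contradiction. *)
Lemma closed_image_separation (p q : T -> X) (E F : set T) :
  dcont d dX p -> dcont d dX q -> dopen d (~` E) -> dopen d (~` F) ->
  p @` E `&` q @` F = set0 -> borel_separated (p @` E) (q @` F).
Proof.
move=> cp cq oE oF pq0; have [//|nsep] := pselect (borel_separated (p @` E) (q @` F)).
have [c Hc] := ex_choice (fun n => pdist_color d (hf_gt0 R n)).
pose bad (AB : set T * set T) := ~ borel_separated (p @` AB.1) (q @` AB.2).
have splt n AB : exists AB', bad AB ->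
    [/\ bad AB', AB'.1 `<=` AB.1, AB'.2 `<=` AB.2 &
      (forall x y, AB'.1 x -> AB'.1 y -> d x y < hf n) /\
      (forall x y, AB'.2 x -> AB'.2 y -> d x y < hf n)].
  have [bAB|] := pselect (bad AB); last by exists AB.
  have [[[i j] bij]|nbij] := pselect (exists k : nat * nat,
      bad (AB.1 `&` [set x | c n x = k.1], AB.2 `&` [set x | c n x = k.2])).
    exists (AB.1 `&` [set x | c n x = i], AB.2 `&` [set x | c n x = j]) => _.
    split => //; [by move=> x []|by move=> x []|].
    by split=> x y [_ /= xi] [_ yi]; apply: Hc; rewrite xi yi.
  exfalso; apply: bAB.
  have -> : p @` AB.1 = \bigcup_i (p @` (AB.1 `&` [set x | c n x = i])).
    by rewrite -image_bigcup; congr image; apply/seteqP; split=> [x Ax|x [i _ []]//]; exists (c n x).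
  have -> : q @` AB.2 = \bigcup_i (q @` (AB.2 `&` [set x | c n x = i])).
    by rewrite -image_bigcup; congr image; apply/seteqP; split=> [x Ax|x [i _ []]//]; exists (c n x).
  apply: borel_separated_bigcup => i j; apply: contrapT => nij; apply: nbij.
  by exists (i, j).
have [st Hst] := ex_choice (fun k : nat * (set T * set T) => splt k.1 k.2).
pose S := fix S n := if n is m.+1 then st (m, S m) else (E, F).
have badS n : bad (S n) by elim: n => [//|n IH]; have [] := Hst (n, S n) IH.
have ne n : (S n).1 !=set0 /\ (S n).2 !=set0.
  split; apply/set0P; apply/eqP => S0; have := badS n;
    rewrite /bad S0 image_set0; apply.
    by exists set0; split; [apply: dborel0|move=> x|move=> x _ []].
  by exists setT; split; [apply: dborelT|move=> x|move=> x].
have sub n : (S n.+1).1 `<=` (S n).1 /\ (S n.+1).2 `<=` (S n).2.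
  by have [] := Hst (n, S n) (badS n).
have subE n : (S n).1 `<=` E /\ (S n).2 `<=` F.
  elim: n => [|n [h1 h2]]; first by split.
  have [g1 g2] := sub n; by split; [move=> x /g1/h1|move=> x /g2/h2].
have [||||a [Ea Ha]] := @nested_small_limit (fun n => (S n).1) E oE.
- by move=> n; case: (subE n).
- by move=> n; case: (sub n).
- by move=> n; case: (ne n).
- by move=> n; have [_ _ _ []] := Hst (n, S n) (badS n).
have [||||b [Fb Hb]] := @nested_small_limit (fun n => (S n).2) F oF.
- by move=> n; case: (subE n).
- by move=> n; case: (sub n).
- by move=> n; case: (ne n).
- by move=> n; have [_ _ _ []] := Hst (n, S n) (badS n).
have pab : p a <> q b.
  move=> pab; have : (p @` E `&` q @` F) (p a).
    by split; [exists a | exists b].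
  by rewrite pq0.
have e0 : 0 < dX (p a) (q b) / 2 by have := pdist_neq dX pab; lra.
have [a1 /Ha[n Hn] Ha1] := cp a _ e0; have [b1 /Hb[m Hm] Hb1] := cq b _ e0.
have mono k l : (S (k + l)%N).1 `<=` (S l).1 /\ (S (k + l)%N).2 `<=` (S l).2.
  elim: k => [|k [h1 h2]]; first by split.
  have [g1 g2] := sub (k + l)%N.
  by rewrite addSn; split; [move=> x /g1/h1|move=> x /g2/h2].
exfalso; have := badS (n + m)%N; rewrite /bad; apply.
exists [set x | dX (p a) x < dX (p a) (q b) / 2]; split.
- by apply: dborel_open; apply: dopen_ball.
- move=> _ [x Sx <-] /=; apply: Ha1; rewrite pdistC; apply: Hn.
  by move: Sx; rewrite addnC => /(mono m n).1.
- move=> _ [x Sx <-] /=; have : dX (q b) (q x) < dX (p a) (q b) / 2.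
    by apply: Hb1; rewrite pdistC; apply: Hm; apply: (mono n m).2.
  have := pdist_tri dX (q x) (p a) (q b); rewrite (pdistC dX (q x)); lra.
Qed.

End Separation.

(** A finer Polish topology makes [E] and [F] closed and keeps [p] and [q] continuous, which reduces
    the claim to closed sets. *)
Lemma image_separation (R : realType) (T X : Type) (d : polmet R T)
    (dX : polmet R X) (p q : T -> X) (E F : set T) :
  dcont d dX p -> dcont d dX q -> dborel d E -> dborel d F ->
  p @` E `&` q @` F = set0 -> borel_separated dX (p @` E) (q @` F).
Proof.
move=> cp cq bE bF pq0.
have [|d' [f' H]] := @dfiner_borel R T d (fun n => if n is 0%N then E else F).
  by case.
have cc (r : T -> X) : dcont d dX r -> dcont d' dX r.
  by move=> /dcontP cr; apply/dcontP => U /cr/f'.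
by apply: (@closed_image_separation _ _ _ d') => //;
  [exact: cc | exact: cc | exact: (H 0%N).2 | exact: (H 1%N).2].
Qed.

(** * The Baire category theorem *)

Section Baire.
Variables (R : realType) (T : Type) (d : polmet R T).

Definition nwd (N : set T) := forall V, dopen d V -> V !=set0 ->
  exists W, [/\ dopen d W, W !=set0, W `<=` V & W `&` N = set0].

Lemma baire (M : nat -> set T) V : (forall n, nwd (M n)) -> dopen d V ->
  V !=set0 -> exists x, V x /\ forall n, ~ M n x.
Proof.
move=> nM oV [x0 Vx0].
(* A pair is a centre and a radius. The next closed ball lies inside the present open one and misses
   [M n]. *)
have shrink n (p : T * R) : exists p' : T * R, 0 < p.2 -> [/\ 0 < p'.2, p'.2 <= hf n &
    forall y, d p'.1 y <= p'.2 -> d p.1 y < p.2 /\ ~ M n y].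
  have [p0|] := pselect (0 < p.2); last by exists p.
  have [||W [oW [x Wx] Wp WM]] := nM n [set y | d p.1 y < p.2].
  - exact: dopen_ball.
  - by exists p.1; rewrite /= pdistxx.
  have [e e0 He] := oW x Wx; exists (x, Num.min (e / 2) (hf n)) => _ /=; split.
  - by rewrite lt_min divr_gt0 // hf_gt0.
  - by rewrite ge_min lexx orbT.
  move=> y; rewrite le_min => /andP[xy _].
  have Wy : W y by apply: He; lra.
  split; first exact: Wp.
  by move=> My; have : (W `&` M n) y by []; rewrite WM.
have [st Hst] := ex_choice (fun k : nat * (T * R) => shrink k.1 k.2).
have [e0 e00 He0] := oV x0 Vx0.
pose S := fix S n := if n is m.+1 then st (m, S m) else (x0, e0 / 2).
have S0 n : 0 < (S n).2.
  elim: n => [|n IH]; first by rewrite /= divr_gt0.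
  by have [] := Hst (n, S n) IH.
have ball n y : d (S n.+1).1 y <= (S n.+1).2 -> d (S n).1 y < (S n).2 /\ ~ M n y.
  by have [_ _] := Hst (n, S n) (S0 n); apply.
have mono n m y : d (S (m + n)%N).1 y <= (S (m + n)%N).2 -> d (S n).1 y <= (S n).2.
  elim: m => [//|m IH]; rewrite addSn => /ball[h _].
  by apply: IH; apply: ltW.
have near n m : (n <= m)%N -> d (S n).1 (S m).1 <= (S n).2.
  move=> nm; apply: (@mono n (m - n)%N); rewrite subnK // pdistxx.
  exact: ltW.
have [|l Hl] := @pdist_complete _ _ d (fun n => (S n).1).
  move=> e e1; have [N Ne] : exists N, (hf N : R) < e / 2 by apply: hf_small; lra.
  exists N.+1 => i j Ni Nj; have [_ h _] := Hst (N, S N) (S0 N).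
  have := near _ _ Ni; have := near _ _ Nj.
  have := pdist_triC d (S N.+1).1 (S i).1 (S j).1.
  by move: h; rewrite -/(S N.+1); lra.
have lS n : d (S n).1 l <= (S n).2.
  apply/ler_addgt0Pr => e e1; have [N HN] := Hl e e1.
  have := HN _ (leq_maxl N n); have := near _ _ (leq_maxr N n).
  by have := pdist_tri d (S (maxn N n)).1 (S n).1 l; lra.
exists l; split.
  by apply: He0; have := lS 0%N; rewrite /=; lra.
by move=> n; apply: (ball n l (lS _)).2.
Qed.

End Baire.

                                     

(** * Finite configurations indexed by binary words *)

Definition unpair (k : nat) : nat * nat := odflt (0%N, 0%N) (unpickle k).

Lemma unpairK p : unpair (pickle p) = p.
Proof. by rewrite /unpair pickleK. Qed.

Definition agree (n : nat) (a b : nat -> bool) := forall i, (i < n)%N -> a i = b i.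

                                                                               
                                                      
(** These are the 2^n-tuples of points indexed by binary words of length [n]. The outermost pair is
    split by the last bit, so that gluing two configurations of level [n] creates bit [n] and leaves
    the earlier bits alone. *)
Fixpoint cfg (T : Type) (n : nat) : Type :=
  if n is m.+1 then (cfg T m * cfg T m)%type else T.

Fixpoint pt (T : Type) (n : nat) : cfg T n -> (nat -> bool) -> T :=
  match n with
  | 0 => fun z _ => z
  | m.+1 => fun z a => pt (if a m then z.2 else z.1) a
  end.

(** A box: the index configuration [i] tells which of the sets [P] must contain each coordinate. *)
Fixpoint allpt (T : Type) (n : nat) (P : nat -> set T) : cfg nat n -> set (cfg T n) :=
  match n with
  | 0 => fun i z => P i z
  | m.+1 => fun i z => allpt P i.1 z.1 /\ allpt P i.2 z.2
  end.

Fixpoint cfg_polmet (R : realType) (T : Type) (d : polmet R T) (n : nat) :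
    polmet R (cfg T n) :=
  if n is m.+1 then prod_polmet (cfg_polmet d m) (cfg_polmet d m) else d.

Lemma pt_agree (T : Type) n (z : cfg T n) a b : agree n a b -> pt z a = pt z b.
Proof.
elim: n z => [//|n IH] z ab /=; rewrite (ab n) //.
by apply: IH => i /ltnW; apply: ab.
Qed.

Section Configurations.
Variables (R : realType) (T : Type) (d : polmet R T).

Lemma allptP n (P : nat -> set T) (i : cfg nat n) (z : cfg T n) :
  allpt P i z <-> forall a, P (pt i a) (pt z a).
Proof.
elim: n i z => [|n IH] i z; first by split=> // /(_ (fun=> false)).
split=> [[/IH h1 /IH h2] a|H]; first by rewrite /=; case: ifP.
have fix_bit S (y : cfg S n.+1) b a : pt y (fun k => if k == n then b else a k) =
    pt (if b then y.2 else y.1) a.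
  rewrite /= eqxx; apply: pt_agree => k kn.
  by rewrite ltn_eqF.
split; apply/IH => a.
  by have := H (fun k => if k == n then false else a k); rewrite !(fix_bit _ _ false).
by have := H (fun k => if k == n then true else a k); rewrite !(fix_bit _ _ true).
Qed.

Lemma dcont_pt n a : dcont (cfg_polmet d n) d (fun z => pt z a).
Proof.
elim: n => [|n IH] /=; first exact: dcont_id.
by case: (a n); [apply: dcont_comp (dcont_snd _ _) IH | apply: dcont_comp (dcont_fst _ _) IH].
Qed.

Lemma allpt_borel n (P : nat -> set T) (i : cfg nat n) :
  (forall i, dborel d (P i)) -> dborel (cfg_polmet d n) (allpt P i).
Proof.
move=> bP; elim: n i => [|n IH] i /=; first exact: bP.
apply: (@dborelI _ _ _ (fst @^-1` (allpt P i.1)) (snd @^-1` (allpt P i.2))).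
  exact: dborel_preimage (dcont_fst _ _) (IH _).
exact: dborel_preimage (dcont_snd _ _) (IH _).
Qed.

Lemma cfg_nat_enum n : exists e : nat -> cfg nat n, forall i, exists k, e k = i.
Proof.
elim: n => [|n [e He]]; first by exists id => i; exists i.
exists (fun k => (e (unpair k).1, e (unpair k).2)) => -[i j].
have [k <-] := He i; have [l <-] := He j; exists (pickle (k, l)).
by rewrite unpairK.
Qed.

Lemma allpt_cover n (P : nat -> set T) (z : cfg T n) :
  (forall x, exists i, P i x) -> exists i, allpt P i z.
Proof.
move=> cP; elim: n z => [|n IH] z /=; first exact: cP.
by have [i Hi] := IH z.1; have [j Hj] := IH z.2; exists (i, j).
Qed.

End Configurations.

(** * Countable unions of Borel independent sets, and families they cannot hit *)

Section SmallSets.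
Variables (R : realType) (X : Type) (dX : polmet R X).
Variables (Dm : nat -> set X) (F : nat -> X -> X).

Definition gr k x y := Dm k x /\ F k x = y.

Definition independent (C : set X) := forall k x y, C x -> C y -> ~ gr k x y.

(** On these Borel sets the graph has countable Borel chromatic number. They are closed under
    countable unions. *)
Definition small (M : set X) := exists C : nat -> set X,
  (forall i, dborel dX (C i) /\ independent (C i)) /\ M = \bigcup_i C i.

Lemma small0 : small set0.
Proof.
exists (fun=> set0); split=> [i|]; last by rewrite bigcup0.
by split=> [|k x y []]; first apply: dborel0.
Qed.

Lemma small_bigcup (M : nat -> set X) :
  (forall i, small (M i)) -> small (\bigcup_i M i).
Proof.
move=> /ex_choice[C HC]; exists (fun k => C (unpair k).1 (unpair k).2).
split=> [k|]; first by have [+ _] := HC (unpair k).1; apply.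
apply/seteqP; split=> x [i _].
  have [_ ->] := HC i => -[j _ Cx].
  by exists (pickle (i, j)) => //; rewrite unpairK.
move=> Cx; exists (unpair i).1 => //; have [_ ->] := HC (unpair i).1.
by exists (unpair i).2.
Qed.

Lemma smallU M N : small M -> small N -> small (M `|` N).
Proof.
move=> sM sN; rewrite -bigcup2E; apply: small_bigcup => -[|[|n]] //=.
exact: small0.
Qed.

Lemma small_independent C : dborel dX C -> independent C -> small C.
Proof. by move=> bC iC; exists (fun=> C); split=> //; rewrite bigcup_const. Qed.

Lemma small_borel M : small M -> dborel dX M.
Proof. by move=> [C [HC ->]]; apply: dborel_bigcup => i; have [] := HC i. Qed.

Variables (T : Type) (d : polmet R T) (w : T -> X).
Hypothesis w_cont : dcont d dX w.
Hypothesis F_cont : forall k, dcont dX dX (F k).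
Hypothesis Dm_open : forall k, dopen dX (Dm k).

                                                                             
                                                   
(** Bad families form a sigma-ideal. At level 0, badness of [E0] says exactly that [w] maps [E0]
    into a small set, which is the potentially closed case. *)
Definition bad n (E : set (cfg T n)) := exists M, small M /\
  forall z, E z -> exists a, M (w (pt z a)).

Lemma bad_bigcup n (E : nat -> set (cfg T n)) (E' : set (cfg T n)) :
  (forall i, bad (E i)) -> E' `<=` \bigcup_i E i -> bad E'.
Proof.
move=> /ex_choice[M HM] EE; exists (\bigcup_i M i); split.
  by apply: small_bigcup => i; have [] := HM i.
move=> z /EE[i _ Eiz]; have [_ /(_ z Eiz)[a Ma]] := HM i.
by exists a; exists i.
Qed.

                                                                            
                                                                            
                                                
(** By independence, for each [k] the image of [E] is disjoint from its own image under [F k], and a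
    Borel set [C k] separates the two. Inside the intersection [P1] of the [C k], discard the points
    that some [F k] sends back into [P1]: what remains is independent and still contains the image
    of [E]. *)
Lemma borel_independent_hull n (E : set (cfg T n)) s :
  dborel (cfg_polmet d n) E -> independent ((fun z => w (pt z s)) @` E) ->
  exists C, [/\ dborel dX C, independent C & (fun z => w (pt z s)) @` E `<=` C].
Proof.
set p := fun z => w (pt z s) => bE iE; set dn := cfg_polmet d n.
have cp : dcont dn dX p by apply: dcont_comp w_cont; apply: dcont_pt.
have sep k : borel_separated dX (p @` E) ((F k \o p) @` (E `&` p @^-1` (Dm k))).
  apply: (@image_separation _ _ _ dn) => //.
  - by apply: dcont_comp (F_cont k).
  - by apply: dborelI => //; apply: dborel_preimage cp _; apply: dborel_open.
  apply/seteqP; split=> // _ [[z Ez <-] [z' [Ez' Dz'] /= Fz]].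
  by apply: (iE k (p z') (p z)); [exists z'|exists z|].
have [C HC] := ex_choice sep.
pose P1 := \bigcap_k C k; have bP1 : dborel dX P1.
  by apply: dborel_bigcap => k; have [] := HC k.
exists (P1 `&` \bigcap_k ~` (Dm k `&` F k @^-1` P1)); split.
- apply: dborelI => //; apply: dborel_bigcap => k; apply: dborelC.
  apply: dborelI; first exact: dborel_open.
  exact: dborel_preimage (F_cont k) bP1.
- move=> k x y [_ /(_ k I) hx] [P1y _] [Dx Fx]; apply: hx; split=> //.
  by rewrite /preimage /= Fx.
- move=> x Ex; split=> k _; first by have [_ + _] := HC k; apply.
  move=> [Dx /(_ k I) Fx]; have [_ _] := HC k; move/(_ (F k x)); apply => //.
  by case: Ex => z Ez zx; exists z; rewrite /= ?zx //; split=> //; rewrite /preimage /= zx.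
Qed.

Definition dbl n k s (E : set (cfg T n)) : set (cfg T n.+1) :=
  [set z | [/\ E z.1, E z.2 & gr k (w (pt z.1 s)) (w (pt z.2 s))]].

Lemma borel_gr (S : Type) (dS : polmet R S) k (p q : S -> X) :
  dcont dS dX p -> dcont dS dX q -> dborel dS [set z | gr k (p z) (q z)].
Proof.
move=> cp cq; apply: (@dborelI _ _ _ (p @^-1` Dm k) [set z | F k (p z) = q z]).
  by apply: dborel_preimage cp _; apply: dborel_open.
rewrite -[X in dborel _ X]setCK; apply: dborelC; apply: dborel_open.
exact: dopen_neq (dcont_comp cp (F_cont k)) cq.
Qed.

Lemma dbl_borel n k s (E : set (cfg T n)) : dborel (cfg_polmet d n) E ->
  dborel (cfg_polmet d n.+1) (dbl k s E).
Proof.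
move=> bE; have -> : dbl k s E = (fst @^-1` E `&` snd @^-1` E) `&`
    [set z | gr k (w (pt z.1 s)) (w (pt z.2 s))].
  by apply/seteqP; split=> z; [case|case=> -[]].
have c1 := dcont_fst (cfg_polmet d n) (cfg_polmet d n).
have c2 := dcont_snd (cfg_polmet d n) (cfg_polmet d n).
apply: dborelI; first apply: dborelI.
- exact: dborel_preimage c1 bE.
- exact: dborel_preimage c2 bE.
have cw : dcont (cfg_polmet d n) dX (fun z => w (pt z s)).
  exact: dcont_comp (dcont_pt _ _) w_cont.
by apply: borel_gr; [apply: dcont_comp c1 cw | apply: dcont_comp c2 cw].
Qed.

                                                                           
                                                             
(** Suppose that for every [k] a small set hits all of [dbl k s E]. Among the configurations of [E]
    that avoid all these sets, no edge joins two values at coordinate [s], so these values lie in a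
    Borel independent set. That set together with the small ones hits every configuration of [E]. *)
Lemma dbl_good n s (E : set (cfg T n)) : dborel (cfg_polmet d n) E ->
  ~ bad E -> exists k, ~ bad (dbl k s E).
Proof.
move=> bE gE; apply: contrapT => /forallNP nb.
have /ex_choice[M HM] k : bad (dbl k s E) by apply: contrapT; apply: nb.
pose M' := \bigcup_k M k.
have sM' : small M' by apply: small_bigcup => k; have [] := HM k.
have [e _] := cfg_nat_enum n.
(* The index configuration [e 0] is arbitrary, since the condition imposed is the same for every
   index. *)
pose E' := E `&` allpt (fun=> w @^-1` (~` M')) (e 0%N).
have bE' : dborel (cfg_polmet d n) E'.
  apply: dborelI => //; apply: allpt_borel => _.
  by apply: dborel_preimage w_cont _; apply: dborelC; apply: small_borel.
have [C [bC iC EC]] : exists C, [/\ dborel dX C, independent C & (fun z => w (pt z s)) @` E' `<=` C].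
  apply: borel_independent_hull => // k _ _ [z [Ez /allptP Mz] <-] [z' [Ez' /allptP Mz'] <-] kz.
  have [_ /(_ (z, z'))[|a]] := HM k; first by split.
  by rewrite /=; case: ifP => _ Ma; [apply: (Mz' a)|apply: (Mz a)]; exists k.
apply: gE; exists (M' `|` C); split.
  by apply: smallU => //; apply: small_independent.
move=> z Ez; have [Mz|nMz] := pselect (forall a, ~ M' (w (pt z a))).
  by exists s; right; apply: EC; exists z => //; split=> //; apply/allptP.
have /existsNP[a /contrapT Ma] := nMz.
by exists a; left.
Qed.

(** A countable cover of the points yields countably many boxes covering the configurations, and bad
    families are closed under countable unions. *)
Lemma cover_shrink n (E : set (cfg T n)) (Q : nat -> set T) : ~ bad E ->
  (forall x, exists i, Q i x) -> exists i, ~ bad (E `&` allpt Q i).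
Proof.
move=> gE cQ; apply: contrapT => /forallNP nb; apply: gE.
have [e He] := cfg_nat_enum n.
apply: (@bad_bigcup n (fun k => E `&` allpt Q (e k))).
  by move=> k; apply: contrapT; apply: nb.
move=> z Ez; have [i Hi] := allpt_cover z cQ; have [k ki] := He i.
by exists k => //; split=> //; rewrite ki.
Qed.

Lemma good_neq0 n (E : set (cfg T n)) : ~ bad E -> E !=set0.
Proof.
move=> gE; apply/set0P; apply/eqP => E0; apply: gE; exists set0.
by split; [apply: small0|rewrite E0].
Qed.

End SmallSets.

(** * The Cantor scheme of configurations *)

Lemma agree_trans n a b c : agree n a b -> agree n b c -> agree n a c.
Proof. by move=> ab bc i ni; rewrite ab // bc. Qed.

Lemma agree_sym n a b : agree n a b -> agree n b a.
Proof. by move=> ab i ni; rewrite ab. Qed.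

Lemma agree_le n m a b : (n <= m)%N -> agree m a b -> agree n a b.
Proof. by move=> nm ab i ni; apply: ab; apply: leq_trans nm. Qed.

                                                                               
                                  
(** Cut at length [n], the binary digits of [n] form a dense sequence of words, one of each length,
    as in the definition of the graph G_0. *)
Definition bits (n : nat) (i : nat) : bool := odd (n %/ 2 ^ i).

Lemma bits_dense (a : nat -> bool) n : exists2 m, (n < m)%N & agree n (bits m) a.
Proof.
elim: n a => [|n IH] a; first by exists 1%N.
have [m nm ma] := IH (fun i => a i.+1).
exists (a 0%N + m.*2)%N; first by lia.
move=> [|i] ni.
  by rewrite /bits expn0 divn1 oddD odd_double addbF; case: (a 0%N).
rewrite -(ma i) // /bits expnS divnMA; congr (odd (_ %/ _)).
by case: (a 0%N); lia.
Qed.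

Section Scheme.
Variables (R : realType) (X T : Type) (dX : polmet R X) (d : polmet R T).
Variables (Dm : nat -> set X) (F : nat -> X -> X) (w : T -> X).
Hypothesis w_cont : dcont d dX w.
Hypothesis F_cont : forall k, dcont dX dX (F k).
Hypothesis Dm_open : forall k, dopen dX (Dm k).
Hypothesis Dm_closed : forall k, dopen dX (~` Dm k).
Hypothesis F_inj : forall k x y, Dm k x -> Dm k y -> F k x = F k y -> x = y.
Hypothesis gr_irr : forall k x, ~ gr Dm F k x x.
Variable W : nat -> set X.
Hypothesis W_open : forall i, dopen dX (W i).
Hypothesis W_closed : forall i, dopen dX (~` W i).
Hypothesis W_sep : forall x y, (forall i, W i x <-> W i y) -> x = y.

Let dbad n := @bad R X dX Dm F T w n.

(** An equivalence relation with clopen classes. Unlike smallness of the metric on [X], it allows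
    the inverse [r] to be defined on all of [X] and to be continuous there. *)
Definition agreeW m x y := forall i, (i < m)%N -> (W i x <-> W i y).

Lemma agreeW_le m m' x y : (m <= m')%N -> agreeW m' x y -> agreeW m x y.
Proof. by move=> mm' xy i im; apply: xy; apply: leq_trans mm'. Qed.

Lemma agreeW_sym m x y : agreeW m x y -> agreeW m y x.
Proof. by move=> xy i im; apply: iff_sym; apply: xy. Qed.

Lemma agreeW_trans m x y z : agreeW m x y -> agreeW m y z -> agreeW m x z.
Proof. by move=> xy yz i im; apply: iff_trans (xy i im) (yz i im). Qed.

Lemma agreeW_near m x : exists2 a : R, 0 < a & forall y, dX x y < a -> agreeW m x y.
Proof.
elim: m => [|m [a a0 Ha]]; first by exists 1.
have [b b0 Hb] : exists2 b : R, 0 < b & forall y, dX x y < b -> (W m x <-> W m y).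
  have [Wx|Wx] := pselect (W m x).
    by have [b b0 Hb] := W_open Wx; exists b => // y /Hb.
  by have [b b0 Hb] := W_closed Wx; exists b => // y /Hb.
exists (Num.min a b); first by rewrite lt_min a0.
move=> y; rewrite lt_min => /andP[/Ha xa /Hb xb] i.
by rewrite ltnS leq_eqVlt => /orP[/eqP->|/xa].
Qed.

Lemma adapted_cover n m : exists Q : nat -> set T, [/\ forall i, dborel d (Q i),
  forall x, exists i, Q i x &
  forall i x y, Q i x -> Q i y -> d x y < hf n /\ agreeW m (w x) (w y)].
Proof.
have [c Hc] := pdist_color d (hf_gt0 R n.+2).
pose pat x := [seq `[< W i (w x) >] | i <- iota 0 m].
have patP x y : pat x = pat y -> agreeW m (w x) (w y).
  move=> xy i im; have := congr1 (fun s => nth false s i) xy.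
  rewrite !(nth_map 0%N) ?size_iota // nth_iota // => h.
  by split=> /asboolP; [rewrite h|rewrite -h] => /asboolP.
pose B i := \bigcup_(x in [set x | c x = i]) [set y | d x y < hf n.+2].
exists (fun k => B (unpair k).1 `&` [set x | unpickle (unpair k).2 = Some (pat x)]).
split.
- move=> k; have oB : dopen d (B (unpair k).1).
    by apply: dopen_bigcup => x _; apply: dopen_ball.
  apply: dborel_open => x [Bx /= xk].
  have [e e0 He] := oB x Bx; have [a a0 Ha] := agreeW_near m (w x).
  have [b b0 Hb] := w_cont x a0; exists (Num.min e b); first by rewrite lt_min e0.
  move=> y; rewrite lt_min => /andP[/He By /Hb/Ha xy].
  have pxy : pat x = pat y.
    apply/eq_in_map => i; rewrite mem_iota /= => im.
    by apply: asbool_equiv_eq; apply: xy.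
  by split=> //=; rewrite -pxy.
- move=> x; exists (pickle (c x, pickle (pat x))); rewrite unpairK /= pickleK.
  by split=> //; exists x => //=; rewrite pdistxx hf_gt0.
- move=> k x y [[x' /= cx' x'x] /= px] [[y' /= cy' y'y] /= py]; split.
    have := Hc x' y'; rewrite cx' cy' => /(_ erefl).
    have := pdist_tri d x' x y; have := pdist_tri d y' x' y.
    by rewrite (pdistC d x x') (hfS R n) (hfS R n.+1); have := hf_gt0 R n.+2; lra.
  by apply: patP; move: px; rewrite py => -[].
Qed.

                                                                              
                                                              
(** A configuration built by doubling is connected by edges along a tree and the [F k] are
    injective, so one vertex value in [X] determines all the others. *)
Definition rigid n (E : set (cfg T n)) := forall z z', E z -> E z' ->
  (exists a, w (pt z a) = w (pt z' a)) -> forall a, w (pt z a) = w (pt z' a).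

Lemma dbl_rigid n k s (E : set (cfg T n)) : rigid E -> rigid (dbl Dm F w k s E).
Proof.
move=> rE z z' [E1 E2 [D1 F1]] [E1' E2' [D1' F1']] [a za].
suff [h1 h2] : (forall b, w (pt z.1 b) = w (pt z'.1 b)) /\
               (forall b, w (pt z.2 b) = w (pt z'.2 b)).
  by move=> b /=; case: ifP.
move: za => /=; case: ifP => _ za.
  have h2 := rE _ _ E2 E2' (ex_intro _ a za); split=> //.
  by apply: rE => //; exists s; apply: F_inj D1 D1' _; rewrite F1 F1' h2.
have h1 := rE _ _ E1 E1' (ex_intro _ a za); split=> //.
by apply: rE => //; exists s; rewrite -F1 -F1' h1.
Qed.

(** A common value at one coordinate would by rigidity propagate to coordinate [s], where the glued
    edge would become a loop. *)
Lemma dbl_disjoint n k s (E : set (cfg T n)) z a : rigid E ->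
  dbl Dm F w k s E z -> w (pt z.1 a) <> w (pt z.2 a).
Proof.
move=> rE [E1 E2 gz] za; have := rE _ _ E1 E2 (ex_intro _ a za) s.
by move=> zs; move: gz; rewrite zs => /gr_irr.
Qed.

Lemma separate_all n (z z' : cfg T n) : (forall a, w (pt z a) <> w (pt z' a)) ->
  exists m, forall a, ~ agreeW m (w (pt z a)) (w (pt z' a)).
Proof.
elim: n z z' => [|n IH] z z' zz'.
  apply: contrapT => /forallNP H; apply: (zz' (fun=> false)) => /=.
  apply: W_sep => i; have /existsNP[a /contrapT/(_ i (ltnSn i))] := H i.+1.
  by [].
have half b : exists m, forall a, ~ agreeW m (w (pt (if b then z.2 else z.1) a))
    (w (pt (if b then z'.2 else z'.1) a)).
  apply: IH => a; have := zz' (fun k => if k == n then b else a k).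
  rewrite /= eqxx; rewrite !(@pt_agree _ _ _ _ a) //;
  by move=> k kn; rewrite ltn_eqF.
have [m1 H1] := half false; have [m2 H2] := half true.
exists (maxn m1 m2) => a /=; case: ifP => _ h.
  by apply: (H2 a); apply: agreeW_le h; apply: leq_maxr.
by apply: (H1 a); apply: agreeW_le h; apply: leq_maxl.
Qed.

Definition good n (E : set (cfg T n)) :=
  [/\ dborel (cfg_polmet d n) E, ~ dbad E & rigid E].

Definition refines n (E : set (cfg T n)) (k m : nat) (E' : set (cfg T n.+1)) :=
  [/\ E' `<=` dbl Dm F w k (bits n) E,
      forall z z' a, E' z -> E' z' -> d (pt z a) (pt z' a) < hf n.+1,
      forall z z' a, E' z -> E' z' -> agreeW m (w (pt z a)) (w (pt z' a)) &
      forall z a, E' z -> ~ agreeW m (w (pt z.1 a)) (w (pt z.2 a))].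

(** Doubling provides [k]. Since the halves are disjoint in [X], the doubled family is a countable
    union over the level [m] at which they are separated, so some [m] keeps it good. Finally a good
    box of small cells with constant pattern is chosen. *)
Lemma good_refine n (E : set (cfg T n)) : good E ->
  exists k m E', good E' /\ refines E k m E'.
Proof.
move=> [bE gE rE]; have [k gk] := dbl_good w_cont F_cont Dm_open (bits n) bE gE.
set E1 := dbl _ _ _ _ _ _ in gk.
have [m gm] : exists m, ~ dbad (E1 `&` [set z | forall a, ~ agreeW m (w (pt z.1 a)) (w (pt z.2 a))]).
  apply: contrapT => /forallNP nb; apply: gk.
  apply: (@bad_bigcup _ _ dX Dm F T w n.+1 (fun m => E1 `&` [set z | forall a, ~ agreeW m (w (pt z.1 a)) (w (pt z.2 a))])).
    by move=> m; apply: contrapT; apply: nb.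
  move=> z Ez; have [|m Hm] := @separate_all n z.1 z.2; last by exists m.
  by move=> a; apply: dbl_disjoint Ez.
have [Q [bQ cQ sQ]] := adapted_cover n.+1 m.
have [i gi] := cover_shrink gm cQ.
have [z0 [[E1z0 sz0] /allptP Qz0]] := good_neq0 gi.
have half (z : cfg T n.+1) a b :
    pt (if b then z.2 else z.1) a = pt z (fun k => if k == n then b else a k).
  rewrite /= eqxx; apply: pt_agree => j jn.
  by rewrite ltn_eqF.
exists k, m, (E1 `&` allpt Q i); split; split.
- apply: dborelI; last by apply: allpt_borel.
  by apply: (dbl_borel w_cont F_cont).
- move=> [M [sM HM]]; apply: gi; exists M; split=> // z [[Ez _] Qz].
  by apply: HM.
- by move=> z z' [Ez _] [Ez' _]; apply: (dbl_rigid rE Ez Ez').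
- by move=> z [].
- by move=> z z' a [_ /allptP Qz] [_ /allptP Qz']; have [] := sQ _ _ _ (Qz a) (Qz' a).
- by move=> z z' a [_ /allptP Qz] [_ /allptP Qz']; have [] := sQ _ _ _ (Qz a) (Qz' a).
(* The separation clause was dropped from the refined family, which leaves that family visibly
   Borel. It is recovered from the single witness [z0], because the cells fix all patterns up to
   [m]. *)
move=> z a [Ez /allptP Qz] h; apply: (sz0 a).
rewrite (half z a false) (half z a true) in h.
rewrite (half z0 a false) (half z0 a true).
have [_ h0] := sQ _ _ _ (Qz (fun k => if k == n then false else a k)) (Qz0 (fun k => if k == n then false else a k)).
have [_ h1] := sQ _ _ _ (Qz (fun k => if k == n then true else a k)) (Qz0 (fun k => if k == n then true else a k)).
exact: agreeW_trans (agreeW_trans (agreeW_sym h0) h) h1.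
Qed.

Lemma limit_mem (S : Type) (dS : polmet R S) (E : set S) (x : nat -> S) l N :
  dopen dS (~` E) -> (forall n, (N <= n)%N -> E (x n)) ->
  (forall e : R, 0 < e -> exists N, forall i, (N <= i)%N -> dS (x i) l < e) -> E l.
Proof.
move=> oE Ex xl; apply: (@closed_limit _ _ dS _ (fun n => x (n + N)%N) _ oE).
  by move=> n; apply: Ex; apply: leq_addl.
move=> e /xl[K HK]; exists K => i Ki; apply: HK.
exact: leq_trans (leq_addr _ _).
Qed.

Lemma limit_dcont (S S' : Type) (dS : polmet R S) (dS' : polmet R S') (p : S -> S')
    (x : nat -> S) l : dcont dS dS' p ->
  (forall e : R, 0 < e -> exists N, forall i, (N <= i)%N -> dS (x i) l < e) ->
  (forall e : R, 0 < e -> exists N, forall i, (N <= i)%N -> dS' (p (x i)) (p l) < e).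
Proof.
move=> cp xl e /(cp l)[a /xl[N HN] Ha]; exists N => i /HN.
by rewrite pdistC => /Ha; rewrite pdistC.
Qed.

Lemma agreeW_closed m x : dopen dX (~` [set y | agreeW m x y]).
Proof.
move=> y xy; have [a a0 Ha] := agreeW_near m y.
by exists a => // z /Ha yz xz; apply: xy; apply: agreeW_trans xz (agreeW_sym yz).
Qed.

                                                                             
                                                                             
(** Fusion: with [z n] chosen in the n-th family, the coordinates of [z n] along [a] form a Cauchy
    sequence with limit [phi a]. Closedness of [E0], of the domains and of the pattern classes
    carries membership, edges and separation to the limit. *)
Lemma scheme_limit (E0 : set T) : dopen d (~` E0) ->
  ~ @bad R X dX Dm F T w 0 E0 ->
  exists (phi : (nat -> bool) -> T) (r : X -> nat -> bool) (k : nat -> nat),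
  [/\ forall a, E0 (phi a),
      forall a (e : R), 0 < e -> exists n, forall b, agree n a b -> d (phi a) (phi b) < e,
      forall x n, exists2 e : R, 0 < e & forall y, dX x y < e -> agree n (r x) (r y),
      forall a, r (w (phi a)) = a &
      forall n a b, agree n a (bits n) -> a n = false -> b n = true ->
        (forall i, i != n -> a i = b i) ->
        gr Dm F (k n) (w (phi a)) (w (phi b))].
Proof.
move=> oE0 gE0.
have step n (E : set (cfg T n)) : exists kmE : nat * nat * set (cfg T n.+1),
    good E -> good kmE.2 /\
    refines E kmE.1.1 kmE.1.2 kmE.2.
  have [gE|] := pselect (good E); last by exists (0%N, 0%N, set0).
  have [k [m [E' H]]] := good_refine gE.
  by exists (k, m, E').
pose st n E := projT1 (cid (step n E)).
have Hst n E : good E -> good (st n E).2 /\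
    refines E (st n E).1.1 (st n E).1.2 (st n E).2.
  by rewrite /st; case: cid.
pose fix Es n : set (cfg T n) := match n with 0%N => E0 | n.+1 => (st n (Es n)).2 end.
pose k n := (st n (Es n)).1.1; pose m n := (st n (Es n)).1.2.
have gEs n : good (Es n).
  elim: n => [|n IH]; last by have [] := Hst n _ IH.
  split=> //; first by rewrite -[X in dborel _ X]setCK; apply: dborelC; apply: dborel_open.
  by move=> z z' _ _ [a za] b.
have rEs n : refines (Es n) (k n) (m n) (Es n.+1).
  by have [] := Hst n _ (gEs n).
have [z Hz] : exists z : forall n, cfg T n, forall n, Es n (z n).
  have ex n : exists z, Es n z by have [_ gE _] := gEs n; apply: good_neq0 gE.
  by exists (fun n => projT1 (cid (ex n))) => n; case: cid.
(* The bits of [a] from [n] on select, inside a later configuration, a subconfiguration that belongs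
   to the n-th family. *)
have proj n j y a : Es (j + n)%N y -> exists2 y', Es n y' &
    forall b, (forall i, (n <= i)%N -> a i = b i) -> pt y b = pt y' b.
  elim: j y => [|j IH] y Ey; first by exists y.
  have [/(_ _ Ey)[E1 E2 _] _ _ _] := rEs (j + n)%N.
  have [|y' Ey' Hy'] := IH (if a (j + n)%N then y.2 else y.1); first by case: ifP.
  exists y' => // b ab; rewrite -Hy' //= -ab //; exact: leq_addl.
have projz n i a : (n <= i)%N -> exists2 y', Es n y' &
    forall b, (forall j, (n <= j)%N -> a j = b j) -> pt (z i) b = pt y' b.
  move=> ni; have := Hz i; rewrite -(subnK ni) => Ez.
  by have := @proj n (i - n)%N (z (i - n + n)%N) a; apply.
pose x a n := pt (z n) a.
have x_near a n i : (n < i)%N -> d (x a n.+1) (x a i) < hf n.+1.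
  move=> ni; have [y Ey Hy] := projz n.+1 i a ni.
  by rewrite /x (Hy a) //; have [_ + _ _] := rEs n; apply.
have lim a : exists l, forall e : R, 0 < e ->
    exists N, forall i, (N <= i)%N -> d (x a i) l < e.
  apply: pdist_complete => e e0.
  have [N Ne] : exists N, (hf N : R) < e / 2 by apply: hf_small; lra.
  exists N.+1 => i j Ni Nj; have := x_near a N i Ni; have := x_near a N j Nj.
  have := pdist_triC d (x a N.+1) (x a i) (x a j).
  by have := hf_le R (leqnSn N); lra.
have [phi Hphi] := ex_choice lim.
have phi_near a n : d (x a n.+1) (phi a) <= hf n.+1.
  apply/ler_addgt0Pr => e e0; have [N HN] := Hphi a e e0.
  have := HN _ (leq_maxl N n.+1); have := x_near a n _ (leq_maxr N n.+1).
  by have := pdist_tri d (x a (maxn N n.+1)) (x a n.+1) (phi a); lra.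
have wphi a := limit_dcont w_cont (Hphi a).
have agW n a : agreeW (m n) (w (x a n.+1)) (w (phi a)).
  apply: (@limit_mem _ dX [set y | agreeW (m n) (w (x a n.+1)) y] _ _ n.+1 _ _ (wphi a)).
    exact: agreeW_closed.
  move=> i ni /=; have [y Ey Hy] := projz n.+1 i a ni.
  by rewrite /x (Hy a) //; have [_ _ + _] := rEs n; apply.
(* If [n] is the first difference of [a] and [b], the level [m n] tells their images apart. *)
have sep n a b : agree n a b -> a n <> b n ->
    ~ agreeW (m n) (w (phi a)) (w (phi b)).
  wlog : a b / a n = false.
    move=> H ab anb h; case an : (a n); last exact: (H a b).
    apply: (H b a) => //; [|exact: agree_sym|exact: nesym|exact: agreeW_sym].
    by move: anb; rewrite an; case: (b n).
  move=> an ab; rewrite an; case bn : (b n) => // _ h.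
  have [_ _ _ /(_ (z n.+1) a (Hz _))] := rEs n; apply.
  have : agreeW (m n) (w (x a n.+1)) (w (x b n.+1)).
    exact: agreeW_trans (agreeW_trans (agW n a) h) (agreeW_sym (agW n b)).
  by rewrite /x /= an bn (pt_agree (z n.+1).2 (agree_sym ab)).
have agreeP n a b : (forall i, (i < n)%N -> agreeW (m i) (w (phi a)) (w (phi b))) -> agree n a b.
  elim: n => [//|n IH] H i; have IHn : agree n a b by apply: IH => j jn; apply: H; apply: ltnW.
  rewrite ltnS leq_eqVlt => /orP[/eqP->|]; last exact: IHn.
  by apply: contrapT => ab; apply: sep IHn ab (H n (ltnSn n)).
(* Bit [n] is read off the patterns of [y] at the levels [m 0], ..., [m n] only, hence is locally
   constant. On the image of [w \o phi] these patterns determine the first [n.+1] bits. *)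
pose r y n := `[< exists a, a n = true /\
   forall i, (i < n.+1)%N -> agreeW (m i) y (w (phi a)) >].
exists phi, r, k; split.
- move=> a; apply: (@limit_mem _ d E0 (x a) _ 0%N oE0 _ (Hphi a)) => n _.
  by have [y Ey Hy] := projz 0%N n a (leq0n n); rewrite /x (Hy a).
- move=> a e e0; have [N Ne] : exists N, (hf N : R) < e / 2 by apply: hf_small; lra.
  exists N.+1 => b ab; have := phi_near a N; have := phi_near b N.
  rewrite /x (pt_agree _ ab) => h1 h2.
  have := pdist_triC d (pt (z N.+1) b) (phi a) (phi b); have := hfS R N.
  by have := hf_gt0 R N.+1; lra.
- move=> y n.
  have [a a0 Ha] : exists2 a : R, 0 < a & forall y', dX y y' < a ->
      forall i, (i < n)%N -> agreeW (m i) y y'.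
    elim: n => [|n [a a0 Ha]]; first by exists 1.
    have [b b0 Hb] := agreeW_near (m n) y.
    exists (Num.min a b); first by rewrite lt_min a0.
    move=> y'; rewrite lt_min => /andP[/Ha ya /Hb yb] i.
    by rewrite ltnS leq_eqVlt => /orP[/eqP->|/ya].
  exists a => // y' /Ha yy' i ni; apply: asbool_equiv_eq.
  split=> -[b [bi Hb]]; exists b; split=> // j ji.
    apply: agreeW_trans (Hb j ji); apply: agreeW_sym; apply: yy'.
    exact: leq_trans ni.
  by apply: agreeW_trans (Hb j ji); apply: yy'; apply: leq_trans ni.
- move=> a; apply/funext => n; rewrite /r; case an : (a n); last first.
    apply/asboolP => -[b [bn Hb]]; have := agreeP n.+1 a b Hb n (ltnSn n).
    by rewrite an bn.
  by apply/asboolP; exists a.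
- move=> n a b an an0 bn1 ab.
  (* The edge glued at stage [n] survives in every later configuration, in whatever copy the bits
     beyond [n] select. *)
  have grx i : (n < i)%N -> gr Dm F (k n) (w (x a i)) (w (x b i)).
    move=> ni; have [y Ey Hy] := projz n.+1 i a ni.
    rewrite /x (Hy a) // (Hy b); last by move=> j nj; apply: ab; rewrite gtn_eqF.
    have [/(_ y Ey)[_ _ gy] _ _ _] := rEs n.
    rewrite /= an0 bn1 (pt_agree _ an) (@pt_agree _ _ _ b (bits n)) // => j jn.
    by rewrite -(an j jn) ab // ltn_eqF.
  split.
    apply: (@limit_mem _ dX (Dm (k n)) _ _ n.+1 _ _ (wphi a)) => // i ni.
    by have [] := grx i ni.
  have fa := limit_dcont (F_cont (k n)) (wphi a).
  apply: (@limit_unique _ _ dX (fun i => w (x b i))) (wphi b).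
  move=> e /fa[N HN]; exists (maxn N n.+1) => i.
  by rewrite geq_max => /andP[/HN + ni]; have [_ ->] := grx i ni.
Qed.

End Scheme.

                                                   

(** * Category in Cantor space *)

Notation bseq := (nat -> bool).

Definition copen (U : set bseq) := forall x, U x -> exists n, forall y, agree n x y -> U y.

Lemma cantor_polmet (R : realType) : exists d : polmet R bseq,
  (forall n, exists2 a : R, 0 < a & forall x y, d x y < a -> agree n x y) /\
  (forall e : R, 0 < e -> exists n, forall x y, agree n x y -> d x y < e).
Proof.
pose P n (x y : bseq) : R := if x n == y n then 0 else 1.
have PE n x y : P n x y < 1 -> x n = y n.
  by rewrite /P; case: eqP => // _; rewrite ltxx.
have [||||||d [A B]] := @sup_polmet R bseq P.
- by move=> n x; rewrite /P eqxx.
- by move=> n x y; rewrite /P eq_sym.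
- move=> n y x z; rewrite /P.
  by case: (x n) (y n) (z n) => -[] -[] /=; lra.
- move=> x y xy; apply/funext => n; apply: PE; rewrite xy; exact: ltr01.
- move=> x cx.
  have [N HN] := ex_choice (fun n => cx n 1 ltr01).
  exists (fun n => x (N n) n) => n e e0; exists (N n) => i Ni.
  by rewrite /P (PE _ _ _ (HN n _ _ Ni (leqnn _))) eqxx.
- by move=> n e e0; exists (fun x => nat_of_bool (x n)) => x y; rewrite /P; case: (x n) (y n) => -[].
exists d; split.
  elim=> [|n [a a0 Ha]]; first by exists 1.
  have [b b0 Hb] := A n 1 ltr01; exists (Num.min a b); first by rewrite lt_min a0.
  move=> x y; rewrite lt_min => /andP[/Ha xa /Hb/PE xb] i.
  by rewrite ltnS leq_eqVlt => /orP[/eqP->|/xa].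
move=> e /B[N [a a0 Ha]]; exists N => x y xy; apply: Ha => n nN.
by rewrite /P xy // eqxx.
Qed.

Definition flip k (x : bseq) : bseq := fun i => if i == k then ~~ x i else x i.

Lemma flip_agree k n x y : agree n x y -> agree n (flip k x) (flip k y).
Proof. by move=> xy i ni; rewrite /flip xy. Qed.

Lemma flipK k : involutive (flip k).
Proof. by move=> x; apply/funext => i; rewrite /flip; case: eqP => // _; rewrite negbK. Qed.

Definition cnwd (M : set bseq) := forall x n, exists y m,
  agree n x y /\ forall z, agree m y z -> ~ M z.

Section CantorBaire.
Variable R : realType.

Lemma cantor_baire (M : nat -> set bseq) x n : (forall k, cnwd (M k)) ->
  exists y, agree n x y /\ forall k, ~ M k y.
Proof.
have [d [A B]] := cantor_polmet R.
have dcopen U : copen U -> dopen d U.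
  move=> oU y /oU[k Hk]; have [a a0 Ha] := A k.
  by exists a => // z /Ha/Hk.
have copend U : dopen d U -> copen U.
  move=> oU y /oU[e /B[k Hk] He]; exists k => z /Hk; exact: He.
move=> nM; have [|||y [xy My]] := @baire R bseq d M [set y | agree n x y].
- move=> k V /copend oV [y /[dup] Vy /oV[m Hm]].
  have [z [j [yz Hj]]] := nM k y m.
  exists [set u | agree (maxn m j) z u]; split.
  + apply: dcopen => u zu; exists (maxn m j) => v; exact: agree_trans.
  + by exists z.
  + move=> u zu; apply: Hm; apply: agree_trans yz _; apply: agree_le zu.
    exact: leq_maxl.
  + apply/seteqP; split=> // u [zu]; apply: Hj; apply: agree_le zu.
    exact: leq_maxr.
- apply: dcopen => u zu; exists n => v; exact: agree_trans.
- by exists x.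
by exists y.
Qed.

End CantorBaire.

Lemma cnwd_flip k M : cnwd M -> cnwd (flip k @^-1` M).
Proof.
move=> nM x n; have [y [m [xy Hm]]] := nM (flip k x) n.
exists (flip k y), m; split.
  by rewrite -[x](flipK k); apply: flip_agree.
by move=> z yz; apply: Hm; rewrite -[y](flipK k); apply: flip_agree.
Qed.

                                                                             
                                                                             
                                                          
(** * Making the domains clopen on a dense G-delta set *)

Section Cleaning.
Variable R : realType.
Notation idx := (nat * bool)%type.
Implicit Types (i : idx).
Let inv i : idx := (i.1, ~~ i.2).
Variables (D : idx -> set bseq) (H : idx -> bseq -> bseq).
Hypothesis D_closed : forall i, copen (~` D i).
Hypothesis H_cont : forall i x n, D i x -> exists m, forall y, D i y ->
  agree m x y -> agree n (H i x) (H i y).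
Hypothesis H_inv : forall i x, D i x -> D (inv i) (H i x) /\ H (inv i) (H i x) = x.

Let invK i : inv (inv i) = i.
Proof. by case: i => n b; rewrite /inv /= negbK. Qed.

Let cint (A : set bseq) := [set x | exists n, forall y, agree n x y -> A y].
(** This is the part on which [H i] is a homeomorphism between open sets: [U i] is open and [H i]
    sends it into [U (inv i)]. *)
Let U i := [set x | cint (D i) x /\ cint (D (inv i)) (H i x)].

Let cint_sub A : cint A `<=` A.
Proof. by move=> x [n]; apply. Qed.

Let UD i : U i `<=` D i. Proof. by move=> x [/cint_sub]. Qed.

Let U_open i : copen (U i).
Proof.
move=> x [[n Hn] [k Hk]]; have Dx : D i x by apply: Hn.
have [m Hm] := H_cont k Dx; exists (maxn n m) => y xy.
have ny : agree n x y by apply: agree_le xy; apply: leq_maxl.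
split; first by exists n => z yz; apply: Hn; apply: agree_trans yz.
exists k => z yz; apply: Hk; apply: agree_trans yz; apply: Hm.
  exact: Hn.
by apply: agree_le xy; apply: leq_maxr.
Qed.

Let HU i x : U i x -> U (inv i) (H i x).
Proof.
move=> Ux; have [_ HHx] := H_inv (UD Ux); case: Ux => Dx DHx; split=> //.
by rewrite invK HHx.
Qed.

(** The flag [true] gives the boundary of the closed set [D i], and [false] the boundary of the open
    set [U i]. Off both, [D i] and its interior coincide and [U i] is relatively clopen. *)
Let base (b : idx * bool) : set bseq :=
  if b.2 then D b.1 `\` cint (D b.1)
  else [set x | ~ U b.1 x /\ forall n, exists2 y, agree n x y & U b.1 y].

Let cyl (s : seq bool) (x : bseq) := forall j, (j < size s)%N -> x j = nth false s j.

Let cyl_agree s x y : agree (size s) x y -> cyl s x -> cyl s y.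
Proof. by move=> xy sx j js; rewrite -xy // sx. Qed.

Let cylP n x : exists s, cyl s x /\ forall y, cyl s y -> agree n x y.
Proof.
exists (mkseq x n); split=> [j|y]; rewrite /cyl size_mkseq => h.
  by rewrite nth_mkseq.
by move=> j jn; rewrite h // nth_mkseq.
Qed.

                                                                           
                                                                  
(** Pullbacks of the base sets along finite compositions of the [H i], taken so that the remaining
    points form an invariant set. Restricting each stage to a cylinder inside [U i] keeps the
    pullback closed, and there are only countably many cylinders. *)
Let Fixpoint exc (p : seq (idx * seq bool)) (b : idx * bool) : set bseq :=
  match p with
  | [::] => base b
  | (i, s) :: p => [set x | [/\ cyl s x, cyl s `<=` U i & exc p b (H i x)]]
  end.

Let exc_closed p b : copen (~` exc p b).
Proof.
elim: p => [|[i s] p IH] /=.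
  rewrite /base; case: b => i [] /= x.
    move=> nx; have [Dx|Dx] := pselect (D i x); last first.
      by have [n Hn] := D_closed Dx; exists n => y /Hn ? [].
    have [n Hn] : cint (D i) x by apply: contrapT => ?; apply: nx.
    exists n => y xy [_]; apply; exists n => z yz.
    by apply: Hn; apply: agree_trans yz.
  move=> nx; have [Ux|Ux] := pselect (U i x).
    by have [n Hn] := U_open Ux; exists n => y /Hn ? [].
  have [n Hn] : exists n, forall y, agree n x y -> ~ U i y.
    apply: contrapT => /forallNP h; apply: nx; split=> // n.
    have /existsNP[y Hy] := h n; apply: contrapT => h2; apply: Hy => xy Uy.
    by apply: h2; exists y.
  exists n => y xy [_ /(_ n)[z yz]]; apply: Hn; exact: agree_trans yz.
move=> x nx; have [sU|sU] := pselect (cyl s `<=` U i); last first.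
  by exists 0%N => y _ [].
have [sx|sx] := pselect (cyl s x); last first.
  by exists (size s) => y xy [sy _ _]; apply: sx; apply: cyl_agree sy; apply: agree_sym.
have [n Hn] : exists n, forall y, agree n (H i x) y -> ~ exc p b y.
  by apply: IH => ex; apply: nx.
have [m Hm] := H_cont n (UD (sU _ sx)).
exists m => y xy [sy _]; apply: Hn; apply: Hm => //.
by apply: UD; apply: sU.
Qed.

Let base_nwd b : cnwd (base b).
Proof.
case: b => i [] x n; rewrite /base /=.
  have [[y xy Dy]|nD] := pselect (exists2 y, agree n x y & ~ D i y).
    by have [m Hm] := D_closed Dy; exists y, m; split=> // z /Hm ? [].
  exists x, n; split=> // z xz [_]; apply; exists n => u zu.
  apply: contrapT => Du; apply: nD; exists u => //; exact: agree_trans zu.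
have [[y xy Uy]|nU] := pselect (exists2 y, agree n x y & U i y).
  by have [m Hm] := U_open Uy; exists y, m; split=> // z /Hm ? [].
exists x, n; split=> // z xz [_ /(_ n)[y zy Uy]]; apply: nU; exists y => //.
exact: agree_trans zy.
Qed.

(** Inside the cylinder, map forward by [H i], find nearby an open set free of exceptional points,
    and return by the inverse [H (inv i)]. *)
Let exc_nwd p b : cnwd (exc p b).
Proof.
elim: p => [|[i s] p IH] /=; first exact: base_nwd.
move=> x n; have [sU|sU] := pselect (cyl s `<=` U i); last first.
  by exists x, n; split=> // z _ [].
have [[x' xx' sx']|ns] := pselect (exists2 x', agree n x x' & cyl s x'); last first.
  by exists x, n; split=> // z xz [sz _ _]; apply: ns; exists z.
pose n' := maxn n (size s).
have n'U y : agree n' x' y -> U i y.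
  by move=> xy; apply: sU; apply: cyl_agree sx'; apply: agree_le xy; apply: leq_maxr.
have Ux' : U i x' by apply: n'U.
have [k1 Hk1] := U_open (HU Ux').
have [_ HHx'] := H_inv (UD Ux').
have [k2 Hk2] := H_cont n' (UD (HU Ux')); rewrite HHx' in Hk2.
have [y [m [Hy Hm]]] := IH (H i x') (maxn k1 k2).
have Uy : U (inv i) y by apply: Hk1; apply: agree_le Hy; apply: leq_maxl.
have [] := H_inv (UD Uy); rewrite invK => Dx'' Hx''.
have x'x'' : agree n' x' (H (inv i) y).
  by apply: Hk2; [exact: UD|apply: agree_le Hy; apply: leq_maxr].
have [m' Hm'] := H_cont m Dx''; rewrite Hx'' in Hm'.
exists (H (inv i) y), (maxn n' m'); split.
  by apply: agree_trans xx' _; apply: agree_le x'x''; apply: leq_maxl.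
move=> z Hz [sz _]; apply: Hm; apply: Hm'; first exact: UD (sU _ sz).
by apply: agree_le Hz; apply: leq_maxr.
Qed.

(** [G] is the complement of all exceptional sets. The second and fourth clauses make the domains of
    the maps restricted to [G] clopen in [G]; the last one says that edges of the graph G_0 with
    both ends in [G] occur near every point. *)
Lemma cleaning : exists (O : nat -> set bseq) (U : idx -> set bseq),
  let G x := forall n, O n x in
  [/\ forall n, copen (O n),
      forall i x, G x -> (D i x /\ G (H i x)) <-> U i x,
      forall i, copen (U i),
      forall i x, G x -> ~ U i x -> exists n, forall y, agree n x y -> ~ U i y &
      forall n x, exists m a b,
        [/\ agree n x a /\ agree n x b, agree m a (bits m), a m = false /\ b m = true,
            forall j, j != m -> a j = b j & G a /\ G b]].
Proof.
pose M k := if unpickle k is Some (p, b) then exc p b else set0.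
have nM k : cnwd (M k).
  rewrite /M; case: unpickle => [[p b]|]; first exact: exc_nwd.
  by move=> x n; exists x, n; split=> // z _ [].
have MP p b x : (forall k, ~ M k x) -> ~ exc p b x.
  by move=> /(_ (pickle (p, b))); rewrite /M pickleK.
exists (fun n => ~` M n), U; split.
- move=> n; rewrite /M; case: unpickle => [[p b]|]; first exact: exc_closed.
  by move=> x _; exists 0%N => y _ [].
- move=> i x Gx; have intD j y : (forall k, ~ M k y) -> D j y -> cint (D j) y.
    by move=> Gy Dy; apply: contrapT => ny; apply: (MP [::] (j, true) y Gy).
  split=> [[Dx GHx]|Ux].
    by split; apply: intD => //; have [] := H_inv Dx.
  split; first exact: UD.
  (* If [H i x] were exceptional along the path [p], then [x] would be exceptional along [p]
     prolonged by [i] and a cylinder around [x] inside [U i]. *)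
  move=> k; rewrite /M; case: unpickle => [[p b] ex|//].
  have [n Hn] := U_open Ux; have [s [sx Hs]] := cylP n x.
  by apply: (MP ((i, s) :: p) b x Gx); split=> // y /Hs/Hn.
- exact: U_open.
- move=> i x Gx nUx; apply: contrapT => /forallNP h.
  apply: (MP [::] (i, false) x Gx); split=> // n.
  have /existsNP[y Hy] := h n; apply: contrapT => h2; apply: Hy => xy Uy.
  by apply: h2; exists y.
move=> n x; have [m nm xm] := bits_dense x n.
(* Flipping bit [m] preserves nowhere dense sets, so Baire gives a point in the prescribed cylinder
   that avoids the exceptional sets together with its flip. *)
have [|a [Ha Ga]] := @cantor_baire R
  (fun k => if (unpair k).2 is 0 then M (unpair k).1 else flip m @^-1` (M (unpair k).1))
  (fun j => if j == m then false else bits m j) m.+1.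
  by move=> k; case: (unpair k).2 => [|_]; [exact: nM|apply: cnwd_flip].
have am : agree m a (bits m).
  by move=> j jm; rewrite -Ha ?ltn_eqF // ltnW.
have na : agree n x a.
  by move=> j jn; rewrite am ?xm //; apply: ltn_trans nm.
have a0 : a m = false by rewrite -Ha // eqxx.
exists m, a, (flip m a); split=> //.
- split=> // j jn; rewrite na // /flip ltn_eqF //; exact: ltn_trans nm.
- by rewrite /flip eqxx a0.
- by move=> j jm; rewrite /flip (negbTE jm).
- split=> k; first by have := Ga (pickle (k, 0%N)); rewrite unpairK.
  by have := Ga (pickle (k, 1%N)); rewrite unpairK.
Qed.

End Cleaning.

                                                         

(** * Meager sets *)

Section Category.
Variables (R : realType) (T : Type) (d : polmet R T).

Lemma countable_base : exists Bs : nat -> set T, (forall j, dopen d (Bs j)) /\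
  forall V x, dopen d V -> V x -> exists j, Bs j x /\ Bs j `<=` V.
Proof.
have [c Hc] := ex_choice (fun n => pdist_color d (hf_gt0 R n)).
exists (fun k => \bigcup_(x in [set x | c (unpair k).1 x = (unpair k).2])
  [set y | d x y < hf (unpair k).1]); split=> [k|V x oV Vx].
  by apply: dopen_bigcup => x _; apply: dopen_ball.
have [e e0 He] := oV x Vx.
have [n ne] : exists n, (hf n : R) < e / 3 by apply: hf_small; lra.
exists (pickle (n, c n x)); rewrite unpairK /=; split.
  by exists x => //=; rewrite pdistxx hf_gt0.
move=> y [z /= cz zy]; apply: He; have := Hc _ _ _ cz.
have := pdist_tri d z x y; have := pdistC d x z.
by have := pdist_triC d z x y; lra.
Qed.

Definition meager (N : set T) := exists M : nat -> set T,
  (forall n, nwd d (M n)) /\ N `<=` \bigcup_n M n.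

Lemma meager_sub N N' : N `<=` N' -> meager N' -> meager N.
Proof. by move=> NN [M [nM MN]]; exists M; split=> // x /NN/MN. Qed.

Lemma nwd_meager N : nwd d N -> meager N.
Proof. by move=> nN; exists (fun=> N); split=> // x Nx; exists 0%N. Qed.

Lemma meager_bigcup (N : nat -> set T) : (forall i, meager (N i)) ->
  meager (\bigcup_i N i).
Proof.
move=> /ex_choice[M HM]; exists (fun k => M (unpair k).1 (unpair k).2).
split=> [k|x [i _ Nx]]; first by have [] := HM (unpair k).1.
have [_ /(_ x Nx)[j _ Mx]] := HM i.
by exists (pickle (i, j)) => //; rewrite unpairK.
Qed.

Lemma nwd0 : nwd d set0.
Proof. by move=> V oV V0; exists V; split=> //; rewrite setI0. Qed.

Lemma meagerU N N' : meager N -> meager N' -> meager (N `|` N').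
Proof.
move=> mN mN'; rewrite -bigcup2E; apply: meager_bigcup => -[|[|n]] //=.
exact: nwd_meager nwd0.
Qed.

                             
Lemma nonmeager_open (A V1 : set T) : dopen d V1 -> ~ meager (A `&` V1) ->
  exists V2, [/\ dopen d V2, V2 !=set0, V2 `<=` V1 &
    forall V, dopen d V -> V !=set0 -> V `<=` V2 -> ~ meager (A `&` V)].
Proof.
move=> oV1 nA; apply: contrapT => nV2; apply: nA.
have [Bs [oB hB]] := countable_base.
pose J := [set j | meager (A `&` (V1 `&` Bs j))].
pose N := V1 `\` \bigcup_(j in J) Bs j.
have nN : nwd d N.
  move=> V oV V0; have [VV0|VV0] := pselect (V `&` V1 !=set0); last first.
    exists V; split=> //; apply/seteqP; split=> // x [Vx [V1x _]].
    by apply: VV0; exists x.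
  have [[V' [oV' [x V'x] V'V mV']]|nV'] := pselect (exists V', [/\ dopen d V', V' !=set0,
      V' `<=` V `&` V1 & meager (A `&` V')]).
    have [j [jx jV']] := hB V' x oV' V'x.
    exists (Bs j); split=> //; first by exists x.
      by move=> y /jV'/V'V[].
    apply/seteqP; split=> // y [By [_ ny]]; apply: ny; exists j => //.
    by apply: meager_sub mV' => z [Az [_ /jV' V'z]].
  exfalso; apply: nV2; exists (V `&` V1); split=> //; first exact: dopenI.
  by move=> V' oV' V'0 V'V mV'; apply: nV'; exists V'.
apply: (@meager_sub _ (N `|` \bigcup_j (if pselect (J j) then A `&` (V1 `&` Bs j) else set0))).
  move=> x [Ax V1x]; have [[j Jj Bx]|nx] := pselect ((\bigcup_(j in J) Bs j) x); last by left.
  by right; exists j => //; case: pselect.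
apply: meagerU; first exact: nwd_meager.
apply: meager_bigcup => j; by case: pselect => [Jj|nJj] //=; apply: nwd_meager nwd0.
Qed.

Lemma open_nonmeager V : dopen d V -> V !=set0 -> ~ meager V.
Proof.
move=> oV V0 [M [nM VM]]; have [x [Vx Mx]] := baire nM oV V0.
by have [n _ Mnx] := VM x Vx; apply: (Mx n).
Qed.

End Category.

(** * A finer Polish topology cannot remove all edges near the diagonal *)

Section NotPotentiallyClosed.
Variables (R : realType) (B : Type) (dB D : polmet R B).
Hypothesis finD : dfiner dB D.
Variables (Dm Rn : nat -> set B) (F G : nat -> B -> B).
Hypothesis F_cont : forall k U, dopen dB U -> dopen dB (Dm k `&` F k @^-1` U).
Hypothesis G_cont : forall k U, dopen dB U -> dopen dB (Rn k `&` G k @^-1` U).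
Hypothesis FRn : forall k x, Dm k x -> Rn k (F k x) /\ G k (F k x) = x.
Hypothesis GDm : forall k y, Rn k y -> Dm k (G k y) /\ F k (G k y) = y.
Hypothesis edges : forall b V, dopen dB V -> V b ->
  exists k x, [/\ Dm k x, V x & V (F k x)].
Hypothesis no_edges : forall b, exists2 e : R, 0 < e &
  forall k x, Dm k x -> D b x < e -> D b (F k x) < e -> False.

Let openT : dopen dB setT.
Proof. by move=> x _; exists 1. Qed.

Lemma nwd_pullback k M : nwd dB M -> nwd dB (Dm k `&` F k @^-1` M).
Proof.
move=> nM V oV V0; have [[x [Vx Dx]]|VD] := pselect (V `&` Dm k !=set0); last first.
  exists V; split=> //; apply/seteqP; split=> // x [Vx [Dx _]].
  by apply: VD; exists x.
have oV1 : dopen dB (V `&` (Dm k `&` F k @^-1` setT)) by apply: dopenI => //; apply: F_cont.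
have [||W1 [oW1 [y W1y] W1V W1M]] := nM (Rn k `&` G k @^-1` (V `&` (Dm k `&` F k @^-1` setT))).
- exact: G_cont.
- by exists (F k x); have [h1 h2] := FRn Dx; rewrite /preimage; split=> //=; rewrite h2.
exists (V `&` (Dm k `&` F k @^-1` W1)); split.
- by apply: dopenI => //; apply: F_cont.
- have [Ry [VGy [DGy _]]] := W1V y W1y; exists (G k y); split=> //; split=> //.
  by rewrite /preimage /=; have [_ ->] := GDm Ry.
- by move=> z [].
- apply/seteqP; split=> // z [[Vz [Dz W1z]] [_ Mz]].
  by have : (W1 `&` M) (F k z) by []; rewrite W1M.
Qed.

                                                                           
                                                                           
                                                                             
                                                             
(** At a [dB]-generic point [b0], any [D]-ball around [b0] contains all generic points of some
    [dB]-neighbourhood of [b0]. That neighbourhood contains an edge, and by Baire one with generic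
    ends, which contradicts [no_edges] at [b0]. The category argument is carried out directly on the
    cells of [D]. *)
Lemma not_potentially_closed : [set: B] = set0.
Proof.
apply/seteqP; split=> // b1 _.
have [c Hc] := ex_choice (fun n => pdist_color D (hf_gt0 R n)).
(* The cells form a tree: [A s] is the union of its children, and longer words give smaller
   [D]-diameter. *)
pose A (s : seq nat) := [set b | forall j, (j < size s)%N -> c j b = nth 0%N s j].
have A_small s j x y : (j < size s)%N -> A s x -> A s y -> D x y < hf j.
  by move=> js Ax Ay; apply: Hc; rewrite (Ax j js) (Ay j js).
have A_cons s : A s = \bigcup_i A (rcons s i).
  apply/seteqP; split=> [x Ax|x [i _ Ax] j js].
    exists (c (size s) x) => // j; rewrite size_rcons ltnS nth_rcons leq_eqVlt.
    by case: ltngtP => //= [js _|-> _]; first exact: Ax.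
  have := Ax j; rewrite size_rcons nth_rcons js; apply; exact: ltnW.
(* [W s] is the largest [dB]-open set in which [A s] is nowhere locally meager. The part of [W s]
   not covered by its children is nowhere dense, so a generic point of [W s] follows an infinite
   branch. *)
pose full s V := forall V', dopen dB V' -> V' !=set0 -> V' `<=` V -> ~ meager dB (A s `&` V').
pose W s := \bigcup_(V in [set V | dopen dB V /\ full s V]) V.
have oW s : dopen dB (W s) by apply: dopen_bigcup => V [].
have fullW s : full s (W s).
  move=> V' oV' [x V'x] V'W mA; have [V [oV fV] Vx] := V'W x V'x.
  apply: (fV (V' `&` V)); [exact: dopenI|by exists x|by move=> z []|].
  by apply: meager_sub mA => z [Az []].
have W0 b : W [::] b.
  exists setT => //; split=> // V' oV' V'0 _.
  have -> : A [::] `&` V' = V' by apply/seteqP; split=> [x []|x V'x] //; split.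
  exact: open_nonmeager.
pose M s := W s `\` \bigcup_i W (rcons s i).
have nM s : nwd dB (M s).
  move=> V oV V0; have [VW|VW] := pselect (V `&` W s !=set0); last first.
    exists V; split=> //; apply/seteqP; split=> // x [Vx [Wx _]].
    by apply: VW; exists x.
  have oVW : dopen dB (V `&` W s) by apply: dopenI.
  have nA : ~ meager dB (A s `&` (V `&` W s)) by apply: fullW => // x [].
  have [i ni] : exists i, ~ meager dB (A (rcons s i) `&` (V `&` W s)).
    apply: contrapT => /forallNP h; apply: nA; rewrite A_cons setI_bigcupl.
    by apply: meager_bigcup => i; apply: contrapT; apply: h.
  have [V2 [oV2 V20 V2V fV2]] := nonmeager_open oVW ni.
  exists V2; split=> //; first by move=> x /V2V[].
  apply/seteqP; split=> // x [V2x [_ nx]]; apply: nx; exists i => //.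
  by exists V2.
have branch b s : (forall t, ~ M t b) -> W s b -> exists t : nat -> seq nat,
    [/\ t 0%N = s, forall n, W (t n) b, forall n, size (t n) = (size s + n)%N &
        forall n, A (t n.+1) `<=` A (t n)].
  move=> gb Wb.
  have ext t : exists i, W t b -> W (rcons t i) b.
    have [Wt|] := pselect (W t b); last by exists 0%N.
    apply: contrapT => /forallNP h; apply: (gb t); split=> // -[i _ Wi].
    by apply: (h i).
  have [x Hx] := ex_choice ext.
  exists (fun n => iter n (fun t => rcons t (x t)) s); split=> //.
  - by elim=> [//|n IH]; apply: Hx.
  - by elim=> [|n IH]; rewrite ?addn0 //= size_rcons IH addnS.
  - by move=> n z Az; rewrite A_cons; exists (x (iter n (fun t => rcons t (x t)) s)).
(* Along a branch through [b], choose points of the cells that [dB]-converge to [b]. They are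
   [D]-Cauchy since the cells shrink, and their [D]-limit, being also a [dB]-limit, is [b]. *)
have close b s (e : R) : (forall t, ~ M t b) -> W s b -> 0 < e ->
    exists2 y, A s y & D y b < e.
  move=> gb Wb e0; have [t [t0 Wt st At]] := branch b s gb Wb.
  have [y Hy] : exists y : nat -> B, forall n, A (t n) (y n) /\ dB b (y n) < hf n.
    apply: (@ex_choice _ _ (fun n z => A (t n) z /\ dB b z < hf n)) => n.
    pose V := W (t n) `&` [set z | dB b z < hf n].
    have Vb : V b by split=> //=; rewrite pdistxx hf_gt0.
    have [z [Az [_ bz]]] : A (t n) `&` V !=set0; last by exists z.
    apply/set0P/eqP => AV; apply: (fullW (t n) V) => //.
    - by apply: dopenI => //; apply: dopen_ball.
    - by exists b.
    - by move=> z [].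
    - by rewrite AV; apply: nwd_meager; apply: nwd0.
  have mono n m : (n <= m)%N -> A (t m) `<=` A (t n).
    elim: m => [|m IH]; first by rewrite leqn0 => /eqP->.
    by rewrite leq_eqVlt => /orP[/eqP->//|/IH nm] z /At/nm.
  have [|l Hl] := @pdist_complete _ _ D y.
    move=> e' /hf_small[N Ne]; exists N.+1 => i j Ni Nj.
    apply: lt_trans Ne; apply: (@A_small (t N.+1)); first by rewrite st addnS ltnS leq_addl.
      by apply: (mono _ _ Ni); have [] := Hy i.
    by apply: (mono _ _ Nj); have [] := Hy j.
  have lb : l = b.
    apply: (@limit_unique _ _ dB y) => [|e' /hf_small[N Ne]].
      exact: finer_limit finD Hl.
    exists N => i Ni; rewrite pdistC; apply: lt_trans (Hy i).2 _.
    exact: le_lt_trans (hf_le _ Ni) Ne.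
  have [N HN] := Hl e e0; exists (y N); last by rewrite -lb; apply: HN.
  by rewrite -t0; apply: (mono _ _ (leq0n N)); have [] := Hy N.
pose M' n := if unpickle n is Some s then M s else set0.
have nM' n : nwd dB (M' n) by rewrite /M'; case: unpickle => // *; apply: nwd0.
have M'M b : (forall n, ~ M' n b) -> forall s, ~ M s b.
  by move=> h s; have := h (pickle s); rewrite /M' pickleK.
have [|b0 [_ /M'M g0]] := baire nM' openT; first by exists b1.
have [e e0 He] := no_edges b0.
have [t [t0 Wt st At]] := branch b0 [::] g0 (W0 b0).
have [n ne] : exists n, (hf n : R) < e / 3 by apply: hf_small; lra.
have near b : (forall s, ~ M s b) -> W (t n.+1) b -> D b0 b < e.
  move=> gb Wb; have e3 : 0 < e / 3 by lra.
  have [y Ay yb] := close b _ _ gb Wb e3.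
  have [y0 Ay0 yb0] := close b0 _ _ g0 (Wt n.+1) e3.
  have : D y0 y < hf n by apply: (@A_small (t n.+1)) => //; rewrite st.
  have := pdist_tri D y0 b0 b; have := pdist_tri D y y0 b.
  by rewrite (pdistC D b0 y0); lra.
have [k [x [Dx Wx WFx]]] := edges (oW (t n.+1)) (Wt n.+1).
(* Even indices aside, the family alternates between exceptional sets and their pullbacks by [F k]:
   the edge found in [W (t n.+1)] is moved to one with both ends generic. *)
have [|||z [[Wz [Dz WFz]] gz]] := @baire _ _ dB
  (fun j => if (unpair j).2 is 0 then M' (unpair j).1 else Dm k `&` F k @^-1` M' (unpair j).1)
  (W (t n.+1) `&` (Dm k `&` F k @^-1` W (t n.+1))).
- by move=> j; case: (unpair j).2 => [|_] //; apply: nwd_pullback.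
- by apply: dopenI => //; apply: F_cont.
- by exists x.
apply: (He k z Dz).
  apply: near => //; apply: M'M => j; have := gz (pickle (j, 0%N)); by rewrite unpairK.
apply: near => //; apply: M'M => j; have := gz (pickle (j, 1%N)); rewrite unpairK /= => h Mj.
by apply: h; split.
Qed.

End NotPotentiallyClosed.

                               

(** * Pullbacks of metrics, and topological spaces with a given metric *)

Section PullbackPolmet.
Variables (R : realType) (S T : Type) (d : polmet R T) (p : S -> T).
Hypothesis p_inj : injective p.
Hypothesis p_closed : dopen d (~` range p).

Lemma pullback_polmet : exists d' : polmet R S, forall x y, d' x y = d (p x) (p y).
Proof.
pose D x y := d (p x) (p y).
have Dxx x : D x x = 0 by apply: pdistxx.
have D0 x y : D x y = 0 -> x = y by move=> h; apply: p_inj; apply: pdist_eq0 h.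
have DC x y : D x y = D y x by apply: pdistC.
have Dtri y x z : D x z <= D x y + D y z by apply: pdist_tri.
have Dcomplete (x : nat -> S) :
    (forall e : R, 0 < e -> exists N, forall i j, (N <= i)%N -> (N <= j)%N ->
       D (x i) (x j) < e) ->
    exists l, forall e : R, 0 < e -> exists N, forall i, (N <= i)%N -> D (x i) l < e.
  move=> cx; have [l Hl] := @pdist_complete _ _ d (p \o x) cx.
  have [s _ sl] : range p l.
    by apply: (closed_limit p_closed _ Hl) => n; exists (x n).
  by exists s; rewrite /D sl.
have Dcolor (e : R) : 0 < e -> exists c : S -> nat, forall x y, c x = c y -> D x y < e.
  by move=> /(pdist_color d)[c Hc]; exists (c \o p) => x y /Hc.
by exists (@Polmet R S D Dxx D0 DC Dtri Dcomplete Dcolor).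
Qed.

End PullbackPolmet.

Definition metrizes (R : realType) (Z : topologicalType) (d : polmet R Z) :=
  forall U : set Z, open U <-> dopen d U.

Section Metrizes.
Variable R : realType.

Lemma metrizes_nbhs (Z : topologicalType) (d : polmet R Z) : metrizes d ->
  forall x (P : set Z), nbhs x P <-> exists2 e : R, 0 < e & forall y, d x y < e -> P y.
Proof.
move=> dP x P; rewrite nbhsE; split=> [[Q [+ Qx] QP]|[e e0 He]].
  by move=> /dP/(_ x Qx)[e e0 He]; exists e => // y /He/QP.
exists [set y | d x y < e] => //; split; last by rewrite /= pdistxx.
by apply/dP; apply: dopen_ball.
Qed.

Lemma metrizes_prod (Z1 Z2 : topologicalType) (d1 : polmet R Z1) (d2 : polmet R Z2) :
  metrizes d1 -> metrizes d2 -> metrizes (prod_polmet d1 d2 : polmet R (Z1 * Z2)%type).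
Proof.
move=> m1 m2 U; rewrite openE; split=> oU x /oU.
  move=> [[P Q] /= [/(metrizes_nbhs m1)[a a0 Ha] /(metrizes_nbhs m2)[b b0 Hb]] PQ].
  exists (Num.min a b); first by rewrite lt_min a0.
  move=> y; change (d1 x.1 y.1 + d2 x.2 y.2 < Num.min a b -> U y).
  rewrite lt_min => /andP[h1 h2].
  have := pdist_ge0 d1 x.1 y.1; have := pdist_ge0 d2 x.2 y.2 => g2 g1.
  by apply: PQ; split; [apply: Ha; lra | apply: Hb; lra].
move=> [e e0 He]; have e2 : 0 < e / 2 by lra.
exists ([set y | d1 x.1 y < e / 2], [set y | d2 x.2 y < e / 2]) => /=.
  by split; [apply/(metrizes_nbhs m1)|apply/(metrizes_nbhs m2)]; exists (e / 2).
move=> y [/= h1 h2]; apply: He; change (d1 x.1 y.1 + d2 x.2 y.2 < e); lra.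
Qed.

Lemma metrizes_continuous (Z1 Z2 : topologicalType) (d1 : polmet R Z1)
    (d2 : polmet R Z2) (p : Z1 -> Z2) : metrizes d1 -> metrizes d2 ->
  continuous p <-> dcont d1 d2 p.
Proof.
move=> m1 m2; rewrite continuousP dcontP.
by split=> H U /m2/H/m1.
Qed.

Lemma metrizes_borel (Z : topologicalType) (d : polmet R Z) : metrizes d ->
  forall E : set Z, borel E <-> dborel d E.
Proof.
move=> m E; rewrite /borel /dborel.
suff -> : [set U : set Z | open U] = dopen d by [].
by apply/seteqP; split=> U /m.
Qed.

Lemma metrizes_closed (Z : topologicalType) (d : polmet R Z) : metrizes d ->
  forall E : set Z, closed E <-> dopen d (~` E).
Proof. by move=> m E; rewrite -openC; apply: m. Qed.

Lemma metrizes_metrized (Z : choiceType) (d : polmet R Z) :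
  @metrizes R (metrized d) d.
Proof. exact: metrized_open. Qed.

(** Each point has clopen neighbourhoods of every small size. Countably many are retained by
    choosing one representative per colour class, and those still contain the whole class and hence
    separate points. *)
Lemma clopen_sequence (Z : topologicalType) (d : polmet R Z) :
  metrizes d -> clopen_basis Z ->
  exists W : nat -> set Z, [/\ forall i, dopen d (W i), forall i, dopen d (~` W i) &
    forall x y, (forall i, W i x <-> W i y) -> x = y].
Proof.
move=> m [cop bas].
have ex (l : nat) (x : Z) : exists U : set Z, [/\ clopen U, U x & forall y, U y -> d x y < hf l].
  have /bas[U [cU Ux] UB] : nbhs x [set y | d x y < hf l].
    by apply/(metrizes_nbhs m); exists (hf l) => //; apply: hf_gt0.
  by exists U; split=> // y /UB.
have [V HV] := ex_choice (fun lx : nat * Z => ex lx.1 lx.2).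
have [c Hc] := ex_choice (fun n => pdist_color d (hf_gt0 R n)).
(* The code gives the size of the clopen set, the scale of a ball contained in it, and the colour of
   its centre at that scale. Any point of the same colour then lies in that ball. *)
pose good (k : nat * (nat * nat)) x :=
  c k.2.1 x = k.2.2 /\ forall y, d x y < hf k.2.1 -> V (k.1, x) y.
have [W HW] : exists W : nat * (nat * nat) -> set Z, forall k, clopen (W k) /\
    ((exists x, good k x) -> exists2 x, good k x & W k = V (k.1, x)).
  apply: (@ex_choice _ _ (fun k W => clopen W /\
    ((exists x, good k x) -> exists2 x, good k x & W = V (k.1, x)))) => k.
  have [[x gx]|nx] := pselect (exists x, good k x).
    by exists (V (k.1, x)); split=> [|_]; [have [] := HV (k.1, x)|exists x].
  by exists setT; split=> //; exact: clopenT.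
pose dec k := odflt (0%N, (0%N, 0%N)) (unpickle k).
exists (W \o dec); split.
- by move=> i; apply/m; have [[]] := HW (dec i).
- by move=> i; apply/m; apply: closed_openC; have [[]] := HW (dec i).
move=> x y xy; have [//|/(pdist_neq d) dxy] := pselect (x = y).
have [l le] : exists l, (hf l : R) < d x y / 2 by apply: hf_small; lra.
have [[oV _] Vx Vl] := HV (l, x).
have [e e0 He] := (m _).1 oV x Vx; have [j je] := hf_small e0.
pose k := (l, (j, c j x)).
have gk : good k x by split=> //= z xz; apply: He; apply: lt_trans je.
have [_ /(_ (ex_intro _ x gk))[x' [/= cx' Vx'] Wk]] := HW k.
have Wx : W k x by rewrite Wk; apply: Vx'; apply: Hc; rewrite cx'.
have := xy (pickle k); rewrite /= /dec pickleK /= => -[/(_ Wx)] Wy _.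
rewrite Wk in Wx Wy; have [_ _ V'l] := HV (k.1, x').
have := V'l _ Wx; have := V'l _ Wy => /= h1 h2.
by exfalso; have := pdist_triC d x' x y; lra.
Qed.

                                                                          
                                               
(** The identity outside a clopen domain extends each partial map and its inverse to continuous maps
    of the whole space, which avoids subspaces later on. *)
Lemma converging_extension (Z : topologicalType) (f : nat -> partial_map Z) :
  converging_situation R f -> exists (d : polmet R Z) (F G : nat -> Z -> Z),
  [/\ metrizes d,
      forall k, dcont d d (F k) /\ dcont d d (G k),
      forall k, [/\ dopen d (pdom (f k)), dopen d (~` pdom (f k)),
        dopen d (pran (f k)) & dopen d (~` pran (f k))] &
      forall k, [/\ forall x, pdom (f k) x -> F k x = Defs.pmap (f k) x,
        forall x, pdom (f k) x -> pran (f k) (F k x) /\ G k (F k x) = x &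
        forall y, pran (f k) y -> pdom (f k) (G k y) /\ F k (G k y) = y]].
Proof.
move=> [[_ /polish_polmet[d m]] _ _ fP _].
have ext (A : set Z) (p : Z -> Z) : dopen d A -> dopen d (~` A) ->
    {within A, continuous p} ->
    exists q : Z -> Z, dcont d d q /\ forall x, A x -> q x = p x.
  move=> oA cA cp; exists (fun x => if pselect (A x) then p x else x).
  split; last by move=> x Ax; case: pselect.
  have {cp} : forall X, open X -> open (A `&` p @^-1` X).
    have /m oA' := oA.
    by apply/(continuous_inP p oA'); move: cp; rewrite continuous_open_subspace.
  move=> cp; apply/dcontP => U /[dup] oU /m/cp/m opU x; rewrite /preimage /=.
  case: pselect => [Ax Upx|nAx Ux].
    have [e e0 He] := opU x (conj Ax Upx); exists e => // y /He[Ay Uy].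
    by case: pselect.
  have [e e0 He] := oU x Ux; have [e' e'0 He'] := cA x nAx.
  exists (Num.min e e'); first by rewrite lt_min e0.
  by move=> y; rewrite lt_min => /andP[/He ? /He' ?]; case: pselect.
have exF k : exists FG : (Z -> Z) * (Z -> Z), [/\ dcont d d FG.1, dcont d d FG.2,
    forall x, pdom (f k) x -> FG.1 x = Defs.pmap (f k) x,
    forall x, pdom (f k) x -> pran (f k) (FG.1 x) /\ FG.2 (FG.1 x) = x &
    forall y, pran (f k) y -> pdom (f k) (FG.2 y) /\ FG.1 (FG.2 y) = y].
  have [[cf [g gK cg]] [oD cD] [oR cR]] := fP k.
  have [|||F [cF FE]] := @ext (pdom (f k)) (Defs.pmap (f k)) => //; [exact/m| |].
    by apply/m; apply: closed_openC.
  have [|||G [cG GE]] := @ext (pran (f k)) g => //; [exact/m| |].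
    by apply/m; apply: closed_openC.
  have ran x : pdom (f k) x -> pran (f k) (F x) by move=> Dx; rewrite FE //; exists x.
  have GF x : pdom (f k) x -> G (F x) = x.
    by move=> Dx; rewrite GE; [rewrite FE //; apply: gK; rewrite inE|exact: ran].
  exists (F, G); split=> //= [x Dx|y [x Dx <-]]; first by split; [exact: ran|exact: GF].
  by rewrite -FE // GF.
have [FG H] := ex_choice exF.
exists d, (fun k => (FG k).1), (fun k => (FG k).2); split=> //.
- by move=> k; have [] := H k.
- move=> k; have [_ [oD cD] [oR cR]] := fP k.
  by split; apply/m => //; apply: closed_openC.
- by move=> k; have [] := H k.
Qed.

End Metrizes.

(** On the domain of the restriction the value lies in [B], so the default of [insubd] is never
    taken. *)
Lemma union_graph_prestrict (X : choiceType) (B : set X) (f : nat -> partial_map X) :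
  union_graph (fun n => prestrict B (f n)) = trace_square B (union_graph f).
Proof.
apply/seteqP; split=> -[x y] [n _] /=.
  move=> [/= [Dx Bx] xy]; exists n => //; split=> //=.
  by rewrite -xy /insubd insubT ?inE //.
move=> [/= Dx xy]; exists n => //; split=> /=; last first.
  by apply: val_inj; rewrite val_insubd xy /= (valP y).
by split=> //; rewrite xy; apply: set_mem; apply: (valP y).
Qed.

(** * Exclusivity, and the potentially closed case *)

Section Cases.
Variable R : realType.

Lemma closure_union_graph (X : topologicalType) (f : nat -> partial_map X) x y :
  converging_situation R f -> closure (union_graph f) (x, y) ->
  union_graph f (x, y) \/ x = y.
Proof.
move=> [_ _ _ _ Dlt] clxy; have [|nf] := pselect (union_graph f (x, y)); first by left.
by right; have : [set p : X * X | p.1 = p.2] (x, y) by rewrite Dlt.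
Qed.

Lemma union_graph_diag (X : topologicalType) (f : nat -> partial_map X) x :
  converging_situation R f -> ~ union_graph f (x, x).
Proof.
move=> [_ _ _ _ Dlt]; have : [set p : X * X | p.1 = p.2] (x, x) by [].
by rewrite Dlt => -[].
Qed.

Lemma union_graph_near_diag (X : topologicalType) (f : nat -> partial_map X) x V :
  converging_situation R f -> open V -> V x ->
  exists p, [/\ union_graph f p, V p.1 & V p.2].
Proof.
move=> [_ _ _ _ Dlt] oV Vx; have : [set p : X * X | p.1 = p.2] (x, x) by [].
have nV : nbhs x V by apply: open_nbhs_nbhs.
have nVV : nbhs (x, x) (V `*` V) by exists (V, V).
by rewrite Dlt => -[/(_ _ nVV)[p [fp [V1 V2]]] _]; exists p.
Qed.

(** The map sending [b] to [(b, (u b, v b))] has closed range, being a graph, so the finer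
    topologies pull back to a Polish metric [D] on [B], finer than [dB]. Since [A] is closed for
    them and misses [(u b, v b)], some [D]-ball around [b] contains no edge, whereas every nonempty
    open set of [B] does. *)
Lemma exclusivity (Y Y' X : topologicalType) (A : set (Y * Y'))
    (f : nat -> partial_map X) (B : set X) (tau : Topological B) :
  polish R Y -> polish R Y' -> potentially_closed R A ->
  let Btau : topologicalType := Topological.Pack tau in
  @converging_situation R Btau (fun n => prestrict B (f n)) ->
  @rect_reducible Btau Btau Y Y' (trace_square B (union_graph f)) A -> False.
Proof.
move=> /polish_polmet[dY mY] /polish_polmet[dY' mY'].
move=> [tau1 [tau2 [f1 f2 /polish_polmet[d1 m1] /polish_polmet[d2 m2] cA]]] /=.
set Btau : topologicalType := Topological.Pack tau.
move=> cs [u [v [cu cv Ared]]].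
have [[[b0 _] _] _ _ _ _] := cs.
have [dB [F [G [mB cFG oD FG]]]] := converging_extension cs.
have fin1 : dfiner dY d1 by move=> U /mY/f1/m1.
have fin2 : dfiner dY' d2 by move=> U /mY'/f2/m2.
have {}cu : dcont dB dY u by apply/(metrizes_continuous _ mB mY).
have {}cv : dcont dB dY' v by apply/(metrizes_continuous _ mB mY').
pose p (b : Btau) : B * (Y * Y') := (b, (u b, v b)).
have p_inj : injective p by move=> b b' [].
pose dP := prod_polmet dB (prod_polmet d1 d2).
have p_closed : dopen dP (~` range p).
  have id1 : dcont d1 dY id by apply/dcontP => U /fin1.
  have id2 : dcont d2 dY' id by apply/dcontP => U /fin2.
  have c1 : dcont dP dB fst by apply: dcont_fst.
  have c2 : dcont dP (prod_polmet d1 d2) snd by apply: dcont_snd.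
  have -> : ~` range p = [set z | (u \o fst) z <> (fst \o snd) z] `|`
      [set z | (v \o fst) z <> (snd \o snd) z].
    apply/seteqP; split=> [[b [y y']] nb|[b [y y']] /= nb [b' _ [eb ey ey']]].
      have [uy|uy] := pselect (u b = y); last by left.
      by right=> /= vy; apply: nb; exists b => //; rewrite /p uy vy.
    by case: nb; rewrite -eb -?ey -?ey'; apply.
  have o1 := dopen_neq (dcont_comp c1 cu)
    (dcont_comp (dcont_comp c2 (dcont_fst _ _)) id1).
  have o2 := dopen_neq (dcont_comp c1 cv)
    (dcont_comp (dcont_comp c2 (dcont_snd _ _)) id2).
  by move=> z [/o1|/o2] [e e0 He]; exists e => // z' /He; [left|right].
have [D DE] := pullback_polmet p_inj p_closed.
have {}DE b b' : D b b' = dB b b' + (d1 (u b) (u b') + d2 (v b) (v b')).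
  by rewrite DE.
have finD : dfiner dB D.
  apply/dfinerP => b e e0; exists e => // b'; rewrite DE.
  by have := pdist_ge0 d1 (u b) (u b'); have := pdist_ge0 d2 (v b) (v b'); lra.
have grE k b b' : pdom (prestrict B (f k)) b -> F k b = b' ->
    union_graph (fun n => prestrict B (f n)) (b, b').
  by move=> Db Fb; exists k => //; split=> //=; rewrite -Fb; have [-> ] := FG k.
have Fcont k U : dopen dB U -> dopen dB (pdom (prestrict B (f k)) `&` F k @^-1` U).
  move=> oU; apply: dopenI; first by have [] := oD k.
  by have [cF _] := cFG k; move/dcontP: cF; apply.
have Gcont k U : dopen dB U -> dopen dB (pran (prestrict B (f k)) `&` G k @^-1` U).
  move=> oU; apply: dopenI; first by have [] := oD k.
  by have [_ cG] := cFG k; move/dcontP: cG; apply.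
suff noB : [set: B] = set0 by have : [set: B] b0 by []; rewrite noB.
apply: (@not_potentially_closed R B dB D finD (fun k => pdom (prestrict B (f k)))
  (fun k => pran (prestrict B (f k))) F G Fcont Gcont).
- by move=> k; have [] := FG k.
- by move=> k; have [] := FG k.
- move=> b V /mB oV Vb.
  have [[x y] /= [[k _ [/= Dx xy]] Vx Vy]] := union_graph_near_diag cs oV Vb.
  have [FE _ _] := FG k; exists k, x; split=> //.
  by rewrite FE //=; move: Vy; rewrite -xy.
move=> b; have nA : (~` A) (u b, v b).
  move=> Ab; have := @union_graph_diag Btau _ b cs.
  by rewrite union_graph_prestrict Ared; apply.
have [e e0 He] := (metrizes_closed (metrizes_prod m1 m2) A).1 cA _ nA.
exists (e / 2); first lra.
move=> k x Dx bx bFx.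
have : trace_square B (union_graph f) (x, F k x).
  by rewrite -union_graph_prestrict; apply: grE Dx _.
rewrite Ared; apply: He; rewrite prod_polmetE /=.
move: bx bFx; rewrite !DE.
have := pdist_ge0 dB b x; have := pdist_ge0 dB b (F k x).
have := pdist_ge0 d2 (v b) (v x); have := pdist_ge0 d1 (u b) (u (F k x)).
lra.
Qed.

                                                                            
                                                                      
(** Refine so that the preimages of all [C i] are open. A point off [A] with [u y = v y'] in [C i]
    has the box of these preimages as a neighbourhood, which independence keeps disjoint from [A].
    If [u y] and [v y'] differ, the image lies off the closure of the graph, and continuity
    suffices. *)
Lemma potentially_closed_of_small (Y Y' X : topologicalType) (A : set (Y * Y'))
    (f : nat -> partial_map X) (u : Y -> X) (v : Y' -> X) (dY : polmet R Y)
    (dY' : polmet R Y') (dX : polmet R X) (C : nat -> set X) :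
  metrizes dY -> metrizes dY' -> metrizes dX -> converging_situation R f ->
  dcont dY dX u -> dcont dY' dX v ->
  A = (fun z : Y * Y' => (u z.1, v z.2)) @^-1` union_graph f ->
  (forall i, dborel dX (C i)) ->
  (forall i x y, C i x -> C i y -> ~ union_graph f (x, y)) ->
  (forall y y', u y = v y' -> exists i, C i (u y)) ->
  potentially_closed R A.
Proof.
move=> mY mY' mX cs cu cv -> bC iC NC.
have [d1 [f1 H1]] := dfiner_borel (fun i => dborel_preimage cu (bC i)).
have [d2 [f2 H2]] := dfiner_borel (fun i => dborel_preimage cv (bC i)).
exists (Topological.class (metrized d1)), (Topological.class (metrized d2)).
have m1 := @metrizes_metrized R Y d1; have m2 := @metrizes_metrized R Y' d2.
split.
- by move=> U /mY/f1/m1.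
- by move=> U /mY'/f2/m2.
- exact: (@polmet_polish R (metrized d1) d1 m1).
- exact: (@polmet_polish R (metrized d2) d2 m2).
apply/(metrizes_closed (metrizes_prod m1 m2)) => -[y y'] /= nA.
have [uv|uv] := pselect (u y = v y').
  have [i Ci] := NC y y' uv.
  have [e1 e10 He1] := (H1 i).1 y Ci.
  have [|e2 e20 He2] := (H2 i).1 y'; first by rewrite /preimage /= -uv.
  exists (Num.min e1 e2); first by rewrite lt_min e10.
  move=> [z z'].
  change (d1 y z + d2 y' z' < Num.min e1 e2 -> ~ union_graph f (u z, v z')).
  rewrite lt_min => /andP[h1 h2]; apply: (iC i).
    by apply: He1; have := pdist_ge0 d2 y' z'; lra.
  by apply: He2; have := pdist_ge0 d1 y z; lra.
have ncl : ~ closure (union_graph f) (u y, v y').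
  by move=> /(closure_union_graph cs)[].
have [e e0 He] := (metrizes_closed (metrizes_prod mX mX) _).1 (@closed_closure _ (union_graph f)) _ ncl.
have e2 : 0 < e / 2 by lra.
have /dcontP cu1 : dcont d1 dX u by apply/dcontP => U oU; apply: f1; move/dcontP: cu; apply.
have /dcontP cv1 : dcont d2 dX v by apply/dcontP => U oU; apply: f2; move/dcontP: cv; apply.
have [a a0 Ha] := (dcontP _ _ _).2 cu1 y _ e2.
have [b b0 Hb] := (dcontP _ _ _).2 cv1 y' _ e2.
exists (Num.min a b); first by rewrite lt_min a0.
move=> [z z'].
change (d1 y z + d2 y' z' < Num.min a b -> ~ union_graph f (u z, v z')).
rewrite lt_min => /andP[h1 h2] fz.
apply: (He (u z, v z')); last exact: subset_closure.
change (dX (u y) (u z) + dX (v y') (v z') < e).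
have : dX (u y) (u z) < e / 2 by apply: Ha; have := pdist_ge0 d2 y' z'; lra.
have : dX (v y') (v z') < e / 2 by apply: Hb; have := pdist_ge0 d1 y z; lra.
lra.
Qed.

End Cases.

(** * The new converging situation *)

Section Construction.
Variables (R : realType) (X : topologicalType) (f : nat -> partial_map X).
Variables (dX : polmet R X) (F G : nat -> X -> X).
Hypothesis f_cs : converging_situation R f.
Hypothesis mX : metrizes dX.
Hypothesis FG_cont : forall k, dcont dX dX (F k) /\ dcont dX dX (G k).
Hypothesis f_open : forall k, [/\ dopen dX (pdom (f k)), dopen dX (~` pdom (f k)),
  dopen dX (pran (f k)) & dopen dX (~` pran (f k))].
Hypothesis FG_inv : forall k, [/\ forall x, pdom (f k) x -> F k x = Defs.pmap (f k) x,
  forall x, pdom (f k) x -> pran (f k) (F k x) /\ G k (F k x) = x &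
  forall y, pran (f k) y -> pdom (f k) (G k y) /\ F k (G k y) = y].
Variables (h : bseq -> X) (r : X -> bseq) (k : nat -> nat).
Hypothesis h_cont : forall a (e : R), 0 < e ->
  exists n, forall b, agree n a b -> dX (h a) (h b) < e.
Hypothesis r_cont : forall x n,
  exists2 e : R, 0 < e & forall y, dX x y < e -> agree n (r x) (r y).
Hypothesis rh : forall a, r (h a) = a.
Hypothesis h_edge : forall n a b, agree n a (bits n) -> a n = false -> b n = true ->
  (forall i, i != n -> a i = b i) ->
  pdom (f (k n)) (h a) /\ F (k n) (h a) = h b.

Let dom (i : nat * bool) := if i.2 then pran (f i.1) else pdom (f i.1).
Let map (i : nat * bool) := if i.2 then G i.1 else F i.1.
Let inv (i : nat * bool) := (i.1, ~~ i.2).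

Let dom_closed i : dopen dX (~` dom i).
Proof. by rewrite /dom; case: i => n [] /=; have [] := f_open n. Qed.

Let map_cont i : dcont dX dX (map i).
Proof. by rewrite /map; case: i => n [] /=; have [] := FG_cont n. Qed.

Let map_inv i x : dom i x -> dom (inv i) (map i x) /\ map (inv i) (map i x) = x.
Proof.
by rewrite /dom /map /inv; case: i => n [] /= Dx; have [_ H1 H2] := FG_inv n; [apply: H2|apply: H1].
Qed.

Let hr_cont : dcont dX dX (h \o r).
Proof.
move=> x e /(h_cont (r x))[n Hn]; have [a a0 Ha] := r_cont x n.
by exists a => // y /Ha/Hn.
Qed.

(** The equation [h (r x) = x] characterizes the range of [h], so this closed set consists of the
    parameters that the i-th map, forward or inverse, keeps inside that range. *)
Let D i := [set a | dom i (h a) /\ h (r (map i (h a))) = map i (h a)].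
Let H i a := r (map i (h a)).

Let h_open U : dopen dX U -> copen (h @^-1` U).
Proof.
move=> oU a /oU[e e0 He]; have [n Hn] := h_cont a e0.
by exists n => b /Hn/He.
Qed.

Let D_closed i : copen (~` D i).
Proof.
have -> : ~` D i = h @^-1` (~` dom i) `|`
    h @^-1` [set x | ((h \o r) \o map i) x <> map i x].
  apply/seteqP; split=> a; last by case=> /= h1 [].
  move=> nD; have [Da|Da] := pselect (dom i (h a)); last by left.
  by right=> /= Ha; apply: nD.
have oN := dopen_neq (dcont_comp (map_cont i) hr_cont) (map_cont i).
by move=> a [/(h_open (@dom_closed i))|/(h_open oN)] [n Hn]; exists n => b /Hn; [left|right].
Qed.

Let H_cont i a n : D i a -> exists m, forall b, D i b -> agree m a b ->
  agree n (H i a) (H i b).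
Proof.
move=> _; have [e e0 He] := r_cont (map i (h a)) n.
have [e' e'0 He'] := map_cont i (h a) e0; have [m Hm] := h_cont a e'0.
by exists m => b _ /Hm/He'/He.
Qed.

Let H_inv i a : D i a -> D (inv i) (H i a) /\ H (inv i) (H i a) = a.
Proof.
move=> [Da ha]; have [D'a ga] := map_inv Da.
by rewrite /D /H /= ha ga rh.
Qed.

(** [B] is the image under [h] of the G-delta set given by [cleaning], with the topology of that set
    transported by [h]. The last clause expresses continuity of [r] from [B] to Cantor space, in the
    form used to build the reduction. *)
Lemma converging_restriction : exists (B : set X) (tau : Topological B),
  let Btau : topologicalType := Topological.Pack tau in
  [/\ borel B, @finer B tau,
      @converging_situation R Btau (fun n => prestrict B (f n)),
      forall x, B x -> h (r x) = x &
      forall (S : topologicalType) (q : bseq -> S),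
        (forall a V, open V -> V (q a) -> exists n, forall b, agree n a b -> V (q b)) ->
        continuous (fun b : Btau => q (r (set_val b)))].
Proof.
have [Os [U [oOs dU oU cU eU]]] := cleaning R (@D_closed) H_cont H_inv.
pose Gd x := forall n, Os n x.
have [dC [dC1 dC2]] := cantor_polmet R.
have copend V : copen V -> dopen dC V.
  move=> oV y /oV[n Hn]; have [a a0 Ha] := dC1 n.
  by exists a => // z /Ha/Hn.
have [dG [fG cG tG]] := dfiner_Gdelta (fun n => copend _ (oOs n)).
pose B := [set x | h (r x) = x /\ Gd (r x)].
have rB (b : B) : h (r (val b)) = val b /\ Gd (r (val b)) := set_mem (valP b).
pose rv (b : B) := r (val b).
have hB a : Gd a -> B (h a) by move=> Ga; rewrite /B /= rh.
have rv_inj : injective rv.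
  move=> b b' bb'; apply: val_inj; rewrite -(rB b).1 -(rB b').1.
  by move: bb'; rewrite /rv => ->.
have rv_surj a : Gd a -> exists b : B, rv b = a.
  by move=> Ga; exists (SigSub (mem_set (hB a Ga))); rewrite /rv /= rh.
have rvE : range rv = \bigcap_n Os n.
  apply/seteqP; split=> [_ [b _ <-] n _|a Ga]; first by have [] := rB b.
  by have [|b <-] := rv_surj a; [move=> n; apply: Ga|exists b].
have [|dB dBE] := @pullback_polmet R B _ dG rv rv_inj; first by rewrite rvE.
pose tau := Topological.class (metrized dB); pose Btau := Topological.Pack tau.
have mB : @metrizes R Btau dB by exact: metrizes_metrized.
(* The metric [dG] induces the Cantor topology at points of the G-delta set, so open sets of [B] can
   be described by initial segments of [rv]. *)
pose bopen (V : set B) := forall b, V b -> exists n, forall b', agree n (rv b) (rv b') -> V b'.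
have bopenP V : @open Btau V <-> bopen V.
  rewrite mB; split=> oV b /oV.
    move=> [e e0 He]; have [_ Gb] := rB b.
    have [a a0 Ha] := tG _ Gb e e0; have [n Hn] := dC2 a a0.
    by exists n => b' /Hn/Ha bb'; apply: He; rewrite dBE.
  move=> [n Hn]; have oN : dopen dC [set y | agree n (rv b) y].
    by apply: copend => y by1; exists n => z; apply: agree_trans.
  have [e e0 He] := fG _ oN (rv b) (fun i _ => erefl).
  by exists e => // b'; rewrite dBE => /He/Hn.
have nbh (b : Btau) (V : set Btau) : nbhs b V ->
    exists n, forall b', agree n (rv b) (rv b') -> V b'.
  rewrite nbhsE => -[V' [/bopenP oV' V'b] V'V]; have [n Hn] := oV' b V'b.
  by exists n => b' /Hn/V'V.
pose Q i (b : B) : B := insubd b (map i (val b)).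
pose domB i := [set b : B | U i (rv b)].
have domBE i (b : B) : domB i b <-> dom i (val b) /\ B (map i (val b)).
  have [hb Gb] := rB b; rewrite /domB /= -(dU i _ Gb) /D /H /= hb /B /=.
  by split=> [[[h1 h2] h3]|[h1 [h2 h3]]].
have valQ i (b : B) : domB i b -> val (Q i b) = map i (val b).
  by move=> /domBE[_ Bm]; rewrite /Q val_insubd ifT // inE.
have Q_inv i b : domB i b -> domB (inv i) (Q i b) /\ Q (inv i) (Q i b) = b.
  move=> Db; have [/map_inv[h1 h2] _] := (domBE _ _).1 Db.
  have DQ : domB (inv i) (Q i b).
    by apply/domBE; rewrite valQ // h2; split=> //; apply: set_mem; apply: (valP b).
  by split=> //; apply: val_inj; rewrite valQ // valQ.
have openQ i V : @open Btau V -> @open Btau (domB i `&` Q i @^-1` V).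
  move=> /bopenP oV; apply/bopenP => b [Db Vb]; have [n Hn] := oV _ Vb.
  have rvQ b' : domB i b' -> rv (Q i b') = H i (rv b').
    by move=> Db'; rewrite /rv valQ // /H (rB b').1.
  have DU b' : domB i b' -> D i (rv b') by move=> Ub; have [] := (dU i _ (rB b').2).2 Ub.
  have [m1 Hm1] := oU i _ Db; have [m2 Hm2] := H_cont n (DU _ Db).
  exists (maxn m1 m2) => b' bb'.
  have Db' : domB i b' by apply: Hm1; apply: agree_le bb'; apply: leq_maxl.
  split=> //; apply: Hn; rewrite !rvQ //; apply: Hm2; first exact: DU.
  by apply: agree_le bb'; apply: leq_maxr.
have clopenB i : @clopen Btau (domB i).
  split; first by rewrite -[domB i]setIT -(preimage_setT (Q i)); apply: openQ; exact: openT.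
  rewrite -openC; apply/bopenP => b nUb; have [n Hn] := cU i _ (rB b).2 nUb.
  by exists n => b' /Hn.
have pdomE n : pdom (prestrict B (f n)) = domB (n, false).
  apply/seteqP; split=> b /=.
    by move=> [Db Bb]; apply/domBE; rewrite /dom /map /=; have [-> ] := FG_inv n.
  by move=> /domBE[]; rewrite /dom /map /= => Db; have [-> ] := FG_inv n.
have pmapE n b : domB (n, false) b -> Defs.pmap (prestrict B (f n)) b = Q (n, false) b.
  move=> /domBE[]; rewrite /dom /map /= => Db _.
  by rewrite /Q /map /=; have [-> ] := FG_inv n.
have pranE n : pran (prestrict B (f n)) = domB (n, true).
  apply/seteqP; split=> [_ [b + <-]|b Db].
    by rewrite pdomE => Db; rewrite pmapE //; have [] := Q_inv _ _ Db.
  have [D1 D2] := Q_inv _ _ Db; exists (Q (n, true) b); first by rewrite pdomE.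
  by rewrite pmapE.
(* These edges show both that [B] is perfect, their ends being distinct, and that the diagonal lies
   in the closure of the graph. *)
have edge_near b n : exists b1 b2, [/\ agree n (rv b) (rv b1) /\ agree n (rv b) (rv b2),
    b1 <> b2 & union_graph (fun n => prestrict B (f n)) (b1, b2)].
  have [m [a1 [a2 [[na1 na2] ma [m1 m2] a12 [G1 G2]]]]] := eU n (rv b).
  have [b1 E1] := rv_surj a1 G1; have [b2 E2] := rv_surj a2 G2.
  have V1 : val b1 = h a1 by rewrite -E1 (rB b1).1.
  have V2 : val b2 = h a2 by rewrite -E2 (rB b2).1.
  exists b1, b2; rewrite E1 E2; split=> //.
    by move=> b12; move: m2; rewrite -E2 -b12 E1 m1.
  have [Da Fa] := h_edge ma m1 m2 a12.
  rewrite union_graph_prestrict; exists (k m) => //; split=> /=.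
    by rewrite -set_valE in V1 *; rewrite V1.
  have [<- //] := FG_inv (k m); last by rewrite -set_valE in V1 *; rewrite V1.
  by rewrite -set_valE in V1 V2 *; rewrite V1 V2.
exists B, tau; split.
- apply/(metrizes_borel mX).
  have -> : B = ~` [set x | (h \o r) x <> id x] `&` \bigcap_n (r @^-1` Os n).
    apply/seteqP; split=> x [/= h1 h2]; split.
    + by move=> /(_ h1).
    + by move=> n _; apply: h2.
    + exact: contrapT.
    + by move=> n; apply: (h2 n).
  apply: dborelI.
    apply: dborelC; apply: dborel_open.
    exact: dopen_neq hr_cont (@dcont_id _ _ dX).
  apply: dborel_bigcap => n; apply: dborel_open => x Ox.
  have [m Hm] := oOs n _ Ox; have [e e0 He] := r_cont x m.
  by exists e => // y /He/Hm.
- move=> _ [A oA <-]; apply/bopenP => b Ab.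
  have [|n Hn] := @h_open _ ((mX A).1 oA) (rv b).
    by rewrite /preimage /= (rB b).1.
  by exists n => b' /Hn; rewrite /preimage /= (rB b').1.
- split.
  + split; last exact: polmet_polish mB.
    have [m [a [_ [_ _ _ _ [Ga _]]]]] := eU 0%N (fun=> false).
    by have [b _] := rv_surj a Ga; exists b.
  + split=> [V []//|b V /nbh[n Hn]].
    exists [set b' | agree n (rv b) (rv b')] => //.
    split=> //; split; first by apply/bopenP => b1 bb1; exists n => b2; apply: agree_trans.
    rewrite -openC; apply/bopenP => b1 bb1; exists n => b2 b12 bb2; apply: bb1.
    exact: agree_trans bb2 (agree_sym b12).
  + split; first exact: closedT.
    apply/seteqP; split=> // b _ V /nbh[n Hn].
    have [b1 [b2 [[bb1 bb2] b12 _]]] := edge_near b n.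
    have [bb|bb] := pselect (b1 = b); last first.
      by exists b1; split=> //; [exact/eqP|apply: Hn].
    exists b2; split=> //; last exact: Hn.
    by apply/eqP => b2b; apply: b12; rewrite bb.
  + move=> n; rewrite pranE pdomE; split; [|exact: clopenB|exact: clopenB].
    have win i (p : B -> B) : (forall b, domB i b -> p b = Q i b) ->
        {within (domB i : set Btau), continuous (p : Btau -> Btau)}.
      move=> pQ; have [oD _] := clopenB i.
      rewrite (@continuous_open_subspace Btau Btau (domB i) p oD).
      apply/(@continuous_inP Btau Btau (domB i) p oD) => V oV.
      suff -> : domB i `&` p @^-1` V = domB i `&` Q i @^-1` V by apply: openQ.
      by apply/seteqP; split=> b [Db Vb]; split=> //; move: Vb; rewrite /preimage /= pQ.
    split; first by rewrite pdomE; apply: win => b; apply: pmapE.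
    exists (Q (n, true)); last by rewrite pranE; apply: win.
    move=> b; rewrite pdomE inE => Db; rewrite pmapE //.
    by have [] := Q_inv _ _ Db.
  (* The diagonal is approached by edges and contains none. Conversely, as the topology of [B] is
     finer, a limit of the trace is a limit of the original graph, hence an edge or a diagonal
     point. *)
  + apply/seteqP; split=> [[b b'] /= <-|[b b'] [clb nb] /=].
      split; last first.
        rewrite union_graph_prestrict => gb.
        by have := @union_graph_diag R X f (val b) f_cs; apply.
      move=> V [[V1 V2] [nV1 nV2] V12].
      have [n1 Hn1] := nbh _ _ nV1; have [n2 Hn2] := nbh _ _ nV2.
      have [b1 [b2 [[bb1 bb2] _ gb]]] := edge_near b (maxn n1 n2).
      exists (b1, b2); split=> //; apply: V12; split=> /=.
        by apply: Hn1; apply: agree_le bb1; apply: leq_maxl.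
      by apply: Hn2; apply: agree_le bb2; apply: leq_maxr.
    apply: val_inj; have : closure (union_graph f) (val b, val b').
      move=> V [[V1 V2] /= [+ +] V12]; rewrite !nbhsE.
      move=> [V1' [/mX o1 V1b] V1V] [V2' [/mX o2 V2b] V2V].
      have [|n1 Hn1] := @h_open _ o1 (rv b); first by rewrite /preimage /= (rB b).1.
      have [|n2 Hn2] := @h_open _ o2 (rv b'); first by rewrite /preimage /= (rB b').1.
      have nbB (b0 : Btau) n : nbhs b0 [set b' | agree n (rv b0) (rv b')].
        apply: open_nbhs_nbhs; split=> //.
        by apply/bopenP => b1 bb1; exists n => b2; apply: agree_trans.
      have nVV : @nbhs (Btau * Btau)%type _ (b, b')
          ([set z | agree n1 (rv b) (rv z)] `*` [set z | agree n2 (rv b') (rv z)]).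
        exists ([set z | agree n1 (rv b) (rv z)], [set z | agree n2 (rv b') (rv z)]) => //.
        by split; exact: nbB.
      have [[b1 b2] [gb [/= bb1 bb2]]] := clb _ nVV.
      exists (val b1, val b2); split; first by move: gb; rewrite union_graph_prestrict.
      apply: V12; split=> /=.
        apply: V1V; rewrite -(rB b1).1; exact: (Hn1 _ bb1).
      apply: V2V; rewrite -(rB b2).1; exact: (Hn2 _ bb2).
    move=> /(closure_union_graph f_cs)[gb|//]; exfalso; apply: nb.
    by rewrite union_graph_prestrict.
- by move=> x [].
move=> S q cq; apply/continuousP => V oV; apply/bopenP => b Vb.
have [n Hn] := cq _ V oV Vb.
by exists n => b' bb'; apply: Hn.
Qed.

End Construction.

(** * Assembly of the dichotomy *)

Theorem theorem15 (R : realType) (Y Y' X : topologicalType)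
    (A : set (Y * Y')) (f : nat -> partial_map X) :
  polish R Y -> polish R Y' -> borel A ->
  converging_situation R f ->
  rect_reducible A (union_graph f) ->
  exactly_one
    (potentially_closed R A)
    (exists (B : set X) (tau : Topological B),
       let Btau : topologicalType := Topological.Pack tau in
       [/\ borel B,
           @finer B tau,
           @converging_situation R Btau (fun n => prestrict B (f n)) &
           @rect_reducible Btau Btau Y Y'
             (trace_square B (union_graph f)) A]).
Proof.
move=> pY pY' _ cs [u [v [cu cv AE]]].
split; last first.
  by move=> [pc [B [tau [_ _ csB redB]]]]; apply: (exclusivity pY pY' pc csB redB).
have [dY mY] := polish_polmet pY; have [dY' mY'] := polish_polmet pY'.
have [dX [F [G [mX cFG oD FG]]]] := converging_extension cs.
have [_ cbX _ _ _] := cs; have [W [oW cW sW]] := clopen_sequence mX cbX.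
have {}cu : dcont dY dX u by apply/(metrizes_continuous _ mY mX).
have {}cv : dcont dY' dX v by apply/(metrizes_continuous _ mY' mX).
(* Only the first coordinate enters [w]; on [E0] the value is also [v z.2]. *)
pose d := prod_polmet dY dY'; pose w (z : Y * Y') := u z.1.
have cw : dcont d dX w by apply: dcont_comp (dcont_fst _ _) cu.
have cF k : dcont dX dX (F k) by have [] := cFG k.
pose Dm k := pdom (f k).
have oDm k : dopen dX (Dm k) by have [] := oD k.
have cDm k : dopen dX (~` Dm k) by have [] := oD k.
have F_inj k x y : Dm k x -> Dm k y -> F k x = F k y -> x = y.
  move=> Dx Dy Fxy; have [_ GF _] := FG k.
  by rewrite -(GF x Dx).2 Fxy (GF y Dy).2.
have grE x y : union_graph f (x, y) <-> exists k, gr Dm F k x y.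
  split=> [[k _ [/= Dx xy]]|[k [Dx xy]]]; exists k => //.
    by split=> //; have [-> ] := FG k.
  by split=> //=; have [<- ] := FG k.
have gr_irr k x : ~ gr Dm F k x x.
  move=> g; apply: (@union_graph_diag R X f x cs); apply/grE; by exists k.
pose E0 := [set z : Y * Y' | u z.1 = v z.2].
have cE0 : dopen d (~` E0).
  exact: dopen_neq cw (dcont_comp (dcont_snd _ _) cv).
(* A configuration of level 0 is a single point of [Y * Y'], so badness here covers the common
   values on [E0] by Borel independent sets. *)
have [[M [[C [HC ->]] HM]]|good] := pselect (@bad R X dX Dm F (Y * Y') w 0 E0).
  left; apply: (potentially_closed_of_small mY mY' mX cs cu cv AE (C := C)).
  - by move=> i; have [] := HC i.
  - by move=> i x y Cx Cy /grE[k]; have [_ iC] := HC i; apply: iC.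
  - move=> y y' uv; have [a [i _ Ci]] := HM (y, y') uv.
    by exists i.
right; have [phi [r [k [phiE phi_cont r_cont rphi edge]]]] :=
  scheme_limit cw cF oDm cDm F_inj gr_irr oW cW sW cE0 good.
have [B [tau [bB fB csB hrB qB]]] := @converging_restriction R X f dX F G cs mX cFG oD FG
  (fun a => w (phi a)) r k (fun a e e0 =>
    let: ex_intro2 b b0 Hb := cw (phi a) e e0 in
    let: ex_intro n Hn := phi_cont a b b0 in
    ex_intro _ n (fun c ac => Hb _ (Hn c ac))) r_cont rphi edge.
exists B, tau; split=> //.
have qc (S : topologicalType) (dS : polmet R S) (q : Y * Y' -> S) : metrizes dS ->
    dcont d dS q ->
    continuous (fun b : Topological.Pack tau => q (phi (r (set_val b)))).
  move=> mS cq; apply: (qB S (fun a => q (phi a))) => a V /mS oV Va.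
  have [e e0 He] := oV _ Va; have [b b0 Hb] := cq (phi a) _ e0.
  by have [n Hn] := phi_cont a b b0; exists n => c /Hn/Hb/He.
(* Since [phi] takes values in [E0] and [w (phi (r x)) = x] on [B], both [u] of the first coordinate
   and [v] of the second give back the point. *)
exists (fun b : Topological.Pack tau => (phi (r (set_val b))).1),
  (fun b : Topological.Pack tau => (phi (r (set_val b))).2); split.
- exact: qc mY (dcont_fst _ _).
- exact: qc mY' (dcont_snd _ _).
rewrite AE; apply/seteqP; split=> -[b b']; rewrite /trace_square /preimage /=;
  by rewrite -[v _]phiE -!/(w _) !hrB //; apply: set_mem; apply: valP.
Qed.
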